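(* Let $\mathbb S$ be a separable real Banach space, let $(U_n\colon u_n\to\mathbb S)_{n\in\omega}$ be a Fraïssé sequence in the normed category $\langle \mathfrak K(\mathbb S)^{\heartsuit},\mathfrak K(\mathbb S)\rangle$ defined in the context (such a sequence exists), where without loss of generality $u_n\subseteq u_{n+1}$ with inclusions as bonding maps, let $\mathbb G(\mathbb S)$ be the completion of $\bigcup_{n\in\omega}u_n$, and let $U_{\mathbb S}\colon\mathbb G(\mathbb S)\to\mathbb S$ be the unique bounded linear operator with $U_{\mathbb S}\restriction u_n=U_n$ for every $n$. Then: (1) For every linear operator $T\colon X\to\mathbb S$ of norm $\leqslant 1$, with $X$ a separable Banach space, there exists a linear isometric embedding $j\colon X\to\mathbb G(\mathbb S)$ such that $U_{\mathbb S}\circ j=T$. (2) Given $\varepsilon>0$, finite-dimensional subspaces $E,E'\subseteq\mathbb G(\mathbb S)$, and an $\varepsilon$-isometric embedding $f\colon E\to E'$ such that $\|U_{\mathbb S}\circ f-U_{\mathbb S}\restriction E\|<\varepsilon$, there exists a bijective linear isometry $h\colon\mathbb G(\mathbb S)\to\mathbb G(\mathbb S)$ such that $U_{\mathbb S}\circ h=U_{\mathbb S}$ and $\|h\restriction E-f\|<\varepsilon$. (3) $U_{\mathbb S}$ is right-invertible and its kernel is linearly isometric to the Gurariĭ space. (4) Conditions (1) and (2) determine $U_{\mathbb S}$ uniquely, up to a linear isometry; that is, if $G'$ is a separable Banach space and $U'\colon G'\to\mathbb S$ is a linear operator of norm $\leqslant 1$ satisfying (1) and (2) with $(\mathbb G(\mathbb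 S),U_{\mathbb S})$ replaced by $(G',U')$, then there is a bijective linear isometry $h\colon\mathbb G(\mathbb S)\to G'$ with $U'\circ h=U_{\mathbb S}$.
   Context: All Banach spaces are real. A linear operator $T\colon E\to F$ is an $\varepsilon$-isometric embedding if $(1+\varepsilon)^{-1}\|x\|<\|Tx\|<(1+\varepsilon)\|x\|$ for every nonzero $x\in E$. The Gurariĭ space is the unique (up to linear isometry) separable Banach space $\mathbb G$ such that: given $\varepsilon>0$, finite-dimensional Banach spaces $X\subseteq Y$ and an isometric embedding $f\colon X\to\mathbb G$, there is an $\varepsilon$-isometric embedding $g\colon Y\to\mathbb G$ with $g\restriction X=f$. The category $\mathfrak K(\mathbb S)$: objects are linear operators $T\colon E\to\mathbb S$ with $E$ a finite-dimensional Banach space and $\|T\|\leqslant1$. An arrow from $T\colon E\to\mathbb S$ to $T'\colon E'\to\mathbb S$ is a linear operator $f\colon E\to E'$ with $\|f\|\leqslant1$ (no commutation with $T,T'$ is required). The distance of two arrows from $T$ to $T'$ is $\rho(f,g)=\|f-g\|$. The subcategory $\mathfrak K(\mathbb S)^{\heartsuit}$ has the same objects, and its arrows from $T$ to $T'$ are the linear isometric embeddings $f\colon E\to E'$ with $T'\circ f=T$. For an arrow $f$ of $\mathfrak K(\mathbb S)$ put $\mu(f)=\inf\{\rho(j\circ f,i)\colon i,j\in\mathfrak K(\mathbb S)^{\heartsuit},\ \operatorname{dom}(j)=\operatorname{cod}(f),\ \operatorname{dom}(i)=\operatorname{dom}(f),\ \operatorname{cod}(i)=\operatorname{cod}(j)\}$,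 with $\inf\emptyset=+\infty$. A sequence $(U_n)_{n\in\omega}$ of objects with bonding arrows $u_n^m$ ($n\leqslant m$) in $\mathfrak K(\mathbb S)^{\heartsuit}$ (a covariant functor from $\omega$) is a Fraïssé sequence if (U) for every object $x$ and every $\varepsilon>0$ there exist $n$ and a $\mathfrak K(\mathbb S)$-arrow $f$ from $x$ to $U_n$ with $\mu(f)<\varepsilon$; (A) given $\varepsilon>0$ and a $\mathfrak K(\mathbb S)^{\heartsuit}$-arrow $f$ from $U_n$ to an object $y$, there exist $m>n$ and a $\mathfrak K(\mathbb S)$-arrow $g$ from $y$ to $U_m$ with $\mu(g)<\varepsilon$ and $\rho(u_n^m,g\circ f)<\varepsilon$. *)

(* Defs.v *)
From HB Require Import structures.
From mathcomp Require Import all_boot all_order all_algebra.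
From mathcomp Require Import all_classical all_reals all_analysis.

Set Implicit Arguments.
Unset Strict Implicit.
Unset Printing Implicit Defensive.

Import Order.TTheory GRing.Theory Num.Theory.
Import numFieldNormedType.Exports.

Local Open Scope classical_set_scope.
Local Open Scope ring_scope.

Section BanachSpaces.
Context {R : realType}.
Implicit Types E F G : completeNormedModType R.

Definition separable (E : topologicalType) : Prop :=
  exists D : set E, countable D /\ dense D.

Definition fin_dim_subspace E (A : set E) : Prop :=
  exists (n : nat) (b : 'I_n -> E),
    A = [set x | exists c : 'I_n -> R, x = \sum_(i < n) c i *: b i].

Definition finite_dimensional E : Prop := fin_dim_subspace [set: E].

(* An operator defined on a linear subspace A of E is represented by a function
   on all of E, whose values outside A are never looked at. *)
Definition linear_on E F (A : set E) (f : E -> F) : Prop :=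
  forall (a : R) (x y : E), A x -> A y -> f (a *: x + y) = a *: f x + f y.

Definition opnorm_on E F (A : set E) (f : E -> F) : \bar R :=
  ereal_sup [set `|f x|%:E | x in A `&` [set x | `|x| <= 1]].

Definition opnorm E F (f : E -> F) : \bar R := opnorm_on [set: E] f.

Definition isometric_on E F (A : set E) (f : E -> F) : Prop :=
  forall x, A x -> `|f x| = `|x|.

Definition isometric E F (f : E -> F) : Prop := isometric_on [set: E] f.

Definition eps_isometric_on (e : R) E F (A : set E) (f : E -> F) : Prop :=
  forall x, A x -> x != 0 ->
    (1 + e)^-1 * `|x| < `|f x| /\ `|f x| < (1 + e) * `|x|.

Definition eps_isometric (e : R) E F (f : E -> F) : Prop :=
  eps_isometric_on e [set: E] f.

Definition is_Gurarii G : Prop :=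
  separable G /\
  forall (e : R), 0 < e ->
  forall Y : completeNormedModType R, finite_dimensional Y ->
  forall X : set Y, fin_dim_subspace X ->
  forall f : Y -> G, linear_on X f -> isometric_on X f ->
  exists g : {linear Y -> G},
    eps_isometric e g /\ (forall x, X x -> g x = f x).

End BanachSpaces.

Section NormedCategory.
Context {R : realType} (S : completeNormedModType R).

Record Kobj := MkKobj {
  Kspace :> completeNormedModType R;
  Kop : {linear Kspace -> S};
  Kspace_fin : finite_dimensional Kspace;
  Kop_le1 : (opnorm Kop <= 1)%E }.

Definition Karrow (x y : Kobj) (f : {linear x -> y}) : Prop :=
  (opnorm f <= 1)%E.

Definition heart_arrow (x y : Kobj) (f : {linear x -> y}) : Prop :=
  isometric f /\ forall z, Kop y (f z) = Kop x z.

Definition rho (x y : Kobj) (f g : x -> y) : \bar R :=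
  opnorm (fun z => f z - g z).

Definition mu (x y : Kobj) (f : {linear x -> y}) : \bar R :=
  ereal_inf [set r | exists (w : Kobj) (j : {linear y -> w})
                            (i : {linear x -> w}),
     [/\ heart_arrow j, heart_arrow i & r = rho (j \o f) i]].

Record heart_seq := MkHeartSeq {
  sobj :> nat -> Kobj;
  bond : forall n m, (n <= m)%N -> {linear sobj n -> sobj m};
  bond_heart : forall n m (nm : (n <= m)%N), heart_arrow (bond nm);
  bond_id : forall n (nn : (n <= n)%N) z, bond nn z = z;
  bond_comp : forall n m k (nm : (n <= m)%N) (mk : (m <= k)%N)
    (nk : (n <= k)%N) z, bond mk (bond nm z) = bond nk z }.

Definition Fraisse_U (U : heart_seq) : Prop :=
  forall (x : Kobj) (e : R), 0 < e ->
  exists (n : nat) (f : {linear x -> U n}), Karrow f /\ (mu f < e%:E)%E.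

Definition Fraisse_A (U : heart_seq) : Prop :=
  forall (e : R), 0 < e ->
  forall (n : nat) (y : Kobj) (f : {linear U n -> y}), heart_arrow f ->
  exists (m : nat) (nm : (n < m)%N) (g : {linear y -> U m}),
    [/\ Karrow g, (mu g < e%:E)%E
      & (rho (bond U (ltnW nm)) (g \o f) < e%:E)%E].

Definition Fraisse_sequence (U : heart_seq) : Prop :=
  Fraisse_U U /\ Fraisse_A U.

(* G is the completion of the union of the spaces of U.  The canonical isometric
   embeddings iota n replace the inclusions: identifying each space with its
   image under iota n turns the bonding maps into inclusions. *)
Definition completed_union (U : heart_seq) (G : completeNormedModType R)
    (iota : forall n, {linear U n -> G}) : Prop :=
  [/\ forall n, isometric (iota n),
      forall n m (nm : (n <= m)%N) z, iota m (bond U nm z) = iota n z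
    & dense (\bigcup_n range (iota n))].

Section Operator.
Context (G : completeNormedModType R) (U : {linear G -> S}).

Definition universal_operator : Prop :=
  forall X : completeNormedModType R, separable X ->
  forall T : {linear X -> S}, (opnorm T <= 1)%E ->
  exists j : {linear X -> G}, isometric j /\ forall x, U (j x) = T x.

Definition almost_homogeneous_operator : Prop :=
  forall (e : R), 0 < e ->
  forall E E' : set G, fin_dim_subspace E -> fin_dim_subspace E' ->
  forall f : G -> G, linear_on E f -> (forall x, E x -> E' (f x)) ->
  eps_isometric_on e E f ->
  (opnorm_on E (fun x => (U (f x) - U x)%R) < e%:E)%E ->
  exists h : {linear G -> G},
    [/\ bijective h, isometric h, forall x, U (h x) = U x
      & (opnorm_on E (fun x => (h x - f x)%R) < e%:E)%E].

Definition right_invertible_operator : Prop :=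
  exists V : {linear S -> G},
    bounded_near V (nbhs 0) /\ forall s, U (V s) = s.

Definition kernel_isometric_to (H : completeNormedModType R) : Prop :=
  exists k : {linear H -> G}, isometric k /\ range k = [set x | U x = 0].

End Operator.

End NormedCategory.

(* Main.v *)
Require Import Defs.
From HB Require Import structures.
From mathcomp Require Import all_boot all_order all_algebra.
From mathcomp Require Import all_classical all_reals all_analysis.
From mathcomp Require Import ring lra.

Set Implicit Arguments.
Unset Strict Implicit.
Unset Printing Implicit Defensive.

Import Order.TTheory GRing.Theory Num.Theory.
Import numFieldNormedType.Exports.

Local Open Scope classical_set_scope.
Local Open Scope ring_scope.

(** The operator [U] is governed by a one-vector extension property, [extendable].
Two tuples, [a] in [G] and [b] in the domain of an operator [T] of norm at most
one, are almost equal with error [q] if linear combinations of them with the same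
coefficients have norms, and images in [S], at distance at most [q] of the
coefficients.  Then
[U] is extendable if, for almost equal [a] and [b] and one more vector [b n], the
tuple [a] can be moved by about [q] and prolonged by a vector so that the error
becomes as small as desired.  Working with tuples instead of operators between
subspaces makes the relation symmetric and frees it of linear independence.

Everything rests on amalgamation ([amalgam_exists]): two spaces with almost equal
tuples embed in one space with an operator of norm at most one, in which the two
tuples are at distance about [q].  The norm is an infimal convolution.  If [a] is
taken from a member of the Fraisse sequence, the amalgam is an object of the
category, the condition [Fraisse_A] sends it back into the sequence, and a small
value of [mu] says that the returning arrow almost preserves the norm and the operator
([mu_lt]).  Hence [U] is extendable ([Fraisse_extendable]).

Iterating the extension with errors proportional to [1 / 2 ^+ k] makes both tuples converge to
tuples whose combinations have exactly equal norms and images, and these define a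
linear isometry ([limit_tuples], [isometry_of_tuples]).  Prolonging the tuple of
[G] only, along a dense sequence of [X], gives universality.  Prolonging both
tuples in turn ([back_and_forth]) gives a bijective isometry between the domains
of two extendable operators that extends an initial almost equality up to its own
error [q]: this is almost homogeneity, where compactness of the unit sphere of
a finite-dimensional space leaves room for the strict inequality.  Uniqueness
is the case of empty tuples, because universality and almost homogeneity imply
extendability ([universal_homogeneous_extendable]): the amalgam embeds in [G'] by
the former, and by the latter the embedding can be chosen to almost fix the given
tuple.

Universality applied to the identity of [S] gives a right inverse of [U].  A
finite-dimensional [Y] embeds in the kernel by universality applied to the zero
operator; almost homogeneity brings this embedding close to a given one on a
subspace, and a correction in coordinates makes the two equal there. *)

(** * Finite linear combinations *)

Section Combinations.
Context {R : realType}.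
Implicit Types (V W : lmodType R) (E : normedModType R) (c d : nat -> R).

Definition comb V n c (v : nat -> V) : V := \sum_(i < n) c i *: v i.

Definition l1 n c : R := \sum_(i < n) `|c i|.

Definition trunc n c : nat -> R := fun i => if (i < n)%N then c i else 0.

Definition update V (v : nat -> V) n x : nat -> V :=
  fun i => if i == n then x else v i.

Lemma eq_comb V n c d (v w : nat -> V) :
  (forall i, (i < n)%N -> c i = d i /\ v i = w i) -> comb n c v = comb n d w.
Proof. by move=> h; apply: eq_bigr => i _; have [-> ->] := h i (ltn_ord i). Qed.

Lemma comb0 V c (v : nat -> V) : comb 0 c v = 0.
Proof. by rewrite /comb big_ord0. Qed.

Lemma combS V n c (v : nat -> V) : comb n.+1 c v = comb n c v + c n *: v n.
Proof. by rewrite /comb big_ord_recr. Qed.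

Lemma combD V n c d (v : nat -> V) :
  comb n (fun i => c i + d i) v = comb n c v + comb n d v.
Proof. by rewrite /comb -big_split; apply: eq_bigr => i _; rewrite scalerDl. Qed.

Lemma combZ V n k c (v : nat -> V) :
  comb n (fun i => k * c i) v = k *: comb n c v.
Proof. by rewrite /comb scaler_sumr; apply: eq_bigr => i _; rewrite scalerA. Qed.

Lemma combN V n c (v : nat -> V) : comb n (fun i => - c i) v = - comb n c v.
Proof. by rewrite /comb -sumrN; apply: eq_bigr => i _; rewrite scaleNr. Qed.

Lemma combB V n c d (v : nat -> V) :
  comb n (fun i => c i - d i) v = comb n c v - comb n d v.
Proof. by rewrite combD combN. Qed.

Lemma comb_const0 V n (v : nat -> V) : comb n (fun=> 0) v = 0.
Proof. by rewrite /comb big1 // => i _; rewrite scale0r. Qed.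

Lemma combBr V n c (v w : nat -> V) :
  comb n c v - comb n c w = comb n c (fun i => v i - w i).
Proof. by rewrite /comb -sumrB; apply: eq_bigr => i _; rewrite scalerBr. Qed.

Lemma linear_comb V W (f : {linear V -> W}) n c (v : nat -> V) :
  f (comb n c v) = comb n c (f \o v).
Proof. by rewrite /comb linear_sum; apply: eq_bigr => i _; rewrite linearZ. Qed.

Lemma comb_trunc V n m c (v : nat -> V) : (n <= m)%N ->
  comb m (trunc n c) v = comb n c v.
Proof.
move=> nm; rewrite /comb /trunc.
rewrite (big_ord_widen m (fun i => c i *: v i) nm) [RHS]big_mkcond.
by apply: eq_bigr => i _; case: ifP => // _; rewrite scale0r.
Qed.

Lemma comb_unit V n k (v : nat -> V) : (k < n)%N ->
  comb n (fun i => (i == k)%:R) v = v k.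
Proof.
move=> kn; rewrite /comb (bigD1 (Ordinal kn)) //= eqxx scale1r big1 ?addr0 //.
move=> i; rewrite -val_eqE /= => /negbTE ->; rewrite scale0r //.
Qed.

Lemma l1_ge0 n c : 0 <= l1 n c.
Proof. by apply: sumr_ge0. Qed.
Hint Resolve l1_ge0 : core.

Lemma l1D n c d : l1 n (fun i => c i + d i) <= l1 n c + l1 n d.
Proof. by rewrite /l1 -big_split; apply: ler_sum => i _; exact: ler_normD. Qed.

Lemma l1Z n k c : l1 n (fun i => k * c i) = `|k| * l1 n c.
Proof. by rewrite /l1 mulr_sumr; apply: eq_bigr => i _; rewrite normrM. Qed.

Lemma eq_l1 n c d : (forall i, (i < n)%N -> c i = d i) -> l1 n c = l1 n d.
Proof. by move=> h; apply: eq_bigr => i _; rewrite h. Qed.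

Lemma l1S n c : l1 n.+1 c = l1 n c + `|c n|.
Proof. by rewrite /l1 big_ord_recr. Qed.

Lemma l1_trunc n m c : (n <= m)%N -> l1 m (trunc n c) = l1 n c.
Proof.
move=> nm; rewrite /l1 /trunc.
rewrite (big_ord_widen m (fun i => `|c i|) nm) [RHS]big_mkcond.
by apply: eq_bigr => i _; case: ifP => // _; rewrite normr0.
Qed.

Lemma l1_unit n k : (k < n)%N -> l1 n (fun i => (i == k)%:R) = 1.
Proof.
move=> kn; rewrite /l1 (bigD1 (Ordinal kn)) //= eqxx normr1 big1 ?addr0 //.
by move=> i; rewrite -val_eqE /= => /negbTE ->; rewrite normr0.
Qed.

Lemma l1_coef n c i : (i < n)%N -> `|c i| <= l1 n c.
Proof.
move=> ilt; rewrite /l1 (bigD1 (Ordinal ilt)) //= lerDl; exact: sumr_ge0.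
Qed.

Lemma l1_widen n m c : (n <= m)%N -> l1 n c <= l1 m c.
Proof.
elim: m => [|m IH]; first by rewrite leqn0 => /eqP ->.
rewrite leq_eqVlt => /orP[/eqP -> //|]; rewrite ltnS => /IH h.
by rewrite l1S (le_trans h) // lerDl.
Qed.

Lemma norm_comb_le E n c (v : nat -> E) M :
  (forall i, (i < n)%N -> `|v i| <= M) -> `|comb n c v| <= M * l1 n c.
Proof.
move=> h; rewrite (le_trans (ler_norm_sum _ _ _)) // /l1 mulr_sumr.
by apply: ler_sum => i _; rewrite normrZ mulrC ler_wpM2r // h.
Qed.

Lemma tuple_bounded E n (v : nat -> E) :
  exists2 M, 0 <= M & forall i, (i < n)%N -> `|v i| <= M.
Proof.
exists (\sum_(i < n) `|v i|); first exact: sumr_ge0.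
by move=> i ilt; rewrite (bigD1 (Ordinal ilt)) //= lerDl; exact: sumr_ge0.
Qed.

Lemma linear_exists V W (f : V -> W) : linear f ->
  exists g : {linear V -> W}, g =1 f.
Proof.
move=> lf; pose g : {linear V -> W} := HB.pack f (GRing.isLinear.Build R V W _ f lf).
by exists g.
Qed.

End Combinations.

(** * Sequences in Banach spaces *)

Section Sequences.
Context {R : realType}.

Lemma half_pow_lt (r e : R) : 0 < e -> exists k : nat, forall n, (k <= n)%N ->
  r / 2 ^+ n < e.
Proof.
move=> e0; exists (Num.bound (`|r| / e)) => n kn.
rewrite ltr_pdivrMr ?exprn_gt0 // mulrC -ltr_pdivrMr //.
apply: (@le_lt_trans _ _ (`|r| / e)).
  by rewrite ler_pM2r ?invr_gt0 // ler_norm.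
apply: (@lt_trans _ _ n%:R).
  by apply: (lt_le_trans (archi_boundP _)); rewrite ?divr_ge0 ?ler_nat // ltW.
by rewrite -natrX ltr_nat ltn_expl.
Qed.

Definition cauchy_in (V : zmodType) (p : V -> R) (v : nat -> V) :=
  forall e, 0 < e -> exists N, forall n m, (N <= n)%N -> (N <= m)%N -> p (v n - v m) < e.

Definition limit_in (V : zmodType) (p : V -> R) (v : nat -> V) l :=
  forall e, 0 < e -> exists N, forall n, (N <= n)%N -> p (v n - l) < e.

Lemma banach_complete (E : completeNormedModType R) (v : nat -> E) :
  cauchy_in Num.norm v -> exists l, limit_in Num.norm v l.
Proof.
move=> cv; have : cvg (v @ \oo).
  apply/cauchy_cvgP/cauchy_ballP => e e0; have [N hN] := cv _ e0.
  rewrite near_map2; exists ([set n | (N <= n)%N], [set n | (N <= n)%N]).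
    by split; exists N.
  by case=> n m [/= Nn Nm]; rewrite -ball_normE /=; exact: hN.
move=> /cvg_ex[l /cvgrPdist_lt vl]; exists l => e /vl[N _ hN].
by exists N => n Nn; rewrite distrC; exact: hN.
Qed.

Lemma cauchy_le (V W : zmodType) (p : V -> R) (p' : W -> R) K
    (v : nat -> V) (w : nat -> W) : 0 < K ->
  (forall n m, p' (w n - w m) <= K * p (v n - v m)) ->
  cauchy_in p v -> cauchy_in p' w.
Proof.
move=> K0 h cv e e0; have [N hN] := cv (e / K) (divr_gt0 e0 K0).
exists N => n m Nn Nm; apply: (le_lt_trans (h n m)).
by rewrite mulrC -ltr_pdivlMr // hN.
Qed.

Lemma geometric_limit (E : completeNormedModType R) (v : nat -> E) K (r : R) :
  (forall k, (K <= k)%N -> `|v k.+1 - v k| <= r / 2 ^+ k) ->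
  exists l, forall k, (K <= k)%N -> `|l - v k| <= (2 * r) / 2 ^+ k.
Proof.
move=> h.
have r0 : 0 <= r.
  have := le_trans (normr_ge0 _) (h K (leqnn _)).
  by rewrite pmulr_lge0 // invr_gt0 exprn_gt0.
have tail k n : (K <= k)%N -> `|v (k + n)%N - v k| <= (2 * r) / 2 ^+ k.
  move=> Kk; suff : `|v (k + n)%N - v k| <= (2 * r) / 2 ^+ k - (2 * r) / 2 ^+ (k + n).
    move=> /le_trans; apply; rewrite gerBl divr_ge0 ?mulr_ge0 ?exprn_ge0 //.
  elim: n => [|n IH]; first by rewrite addn0 !subrr normr0.
  rewrite (le_trans (ler_distD (v (k + n)%N) _ _)) //.
  have := h (k + n)%N (leq_trans Kk (leq_addr _ _)); rewrite addnS => h1.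
  apply: (le_trans (lerD h1 IH)).
  have -> : r / 2 ^+ (k + n) = (2 * r) / 2 ^+ (k + n) - (2 * r) / 2 ^+ (k + n).+1.
    rewrite exprS; field; exact: expf_neq0.
  lra.
have [l hl] : exists l, limit_in Num.norm v l.
  apply: banach_complete => e e0; have [k hk] := half_pow_lt (2 * r) (divr_gt0 e0 (@ltr0n R 2)).
  exists (maxn K k) => n m; rewrite !geq_max => /andP[Kn kn] /andP[Km km].
  wlog nm : n m Kn kn Km km / (n <= m)%N.
    by move=> w; case/orP: (leq_total n m) => ?; [|rewrite distrC]; exact: w.
  rewrite -(subnKC nm) distrC; apply: (le_lt_trans (tail _ _ Kn)).
  apply: (lt_trans (hk _ kn)); rewrite ltr_pdivrMr //; lra.
exists l => k Kk; apply/ler_addgt0Pr => e e0; have [N hN] := hl _ e0.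
have := hN (k + N)%N (leq_addl _ _); rewrite distrC => /ltW h1.
rewrite (le_trans (ler_distD (v (k + N)%N) _ _)) // addrC lerD //; exact: tail.
Qed.

End Sequences.

(** * Constructing Banach spaces from norms *)

Section NormedBy.
Context {R : realType}.

(** Sequential completeness is the form in which completeness gets verified; the
topology being that of a norm, it implies the one for filters. *)
Record banach_norm (V : lmodType R) := BanachNorm {
  bnorm :> V -> R;
  bnormD : forall x y, bnorm (x + y) <= bnorm x + bnorm y;
  bnormZ : forall (k : R) x, bnorm (k *: x) = `|k| * bnorm x;
  bnorm0_eq0 : forall x, bnorm x = 0 -> x = 0;
  bnorm_complete : forall v, cauchy_in bnorm v -> exists l, limit_in bnorm v l }.

Definition normed_by (V : lmodType R) (p : banach_norm V) : Type := V.

Variables (V : lmodType R) (p : banach_norm V).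

HB.instance Definition _ := GRing.Lmodule.on (normed_by p).

HB.instance Definition _ := Lmodule_isNormed.Build R (normed_by p)
  (@bnormD V p) (@bnormZ V p) (@bnorm0_eq0 V p).

(** A Cauchy filter is tracked by centres of members of radius [1 / 2 ^+ k], which
form a Cauchy sequence with the same limit. *)
Lemma normed_by_complete (F : set_system (normed_by p)) :
  ProperFilter F -> cauchy F -> cvg F.
Proof.
move=> FF /cauchyP cF.
have [x xP] : {x : nat -> normed_by p & forall k, F (ball (x k) (1 / 2 ^+ k))}.
  by apply: (@choice _ _ (fun k y => F (ball y (1 / 2 ^+ k)))) => k; apply: cF; rewrite divr_gt0 ?exprn_gt0.
have close k k' : `|x k - x k'| < 1 / 2 ^+ k + 1 / 2 ^+ k'.
  have [z []] := filter_ex (filterI (xP k) (xP k')).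
  rewrite -!ball_normE /= => h1 h2.
  by apply: (le_lt_trans (ler_distD z _ _)); rewrite (distrC z); exact: ltrD.
have [l hl] : exists l : normed_by p, limit_in Num.norm x l.
  apply: (@bnorm_complete V p) => e e0.
  have [N hN] := half_pow_lt (1 : R) (divr_gt0 e0 (@ltr0n R 2)).
  exists N => n m Nn Nm; apply: (lt_trans (close n m)).
  have := hN _ Nn; have := hN _ Nm; lra.
apply/cvg_ex; exists l; apply/cvgrPdist_lt => e e0.
have e20 : 0 < e / 2 by rewrite divr_gt0.
have [N hN] := half_pow_lt (1 : R) e20; have [M hM] := hl _ e20.
have kN : (N <= maxn N M)%N := leq_maxl _ _.
have kM : (M <= maxn N M)%N := leq_maxr _ _.
apply: filterS (xP (maxn N M)) => y; rewrite -ball_normE /= => xy.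
apply: (le_lt_trans (ler_distD (x (maxn N M)) _ _)).
have h1 := hM _ kM; have h2 := hN _ kN.
rewrite distrC in h1; have h1' : `|l - x (maxn N M)| < e / 2 := h1.
move: xy h1' h2; lra.
Qed.

HB.instance Definition _ := Uniform_isComplete.Build (normed_by p)
  normed_by_complete.

End NormedBy.

Section InfConvolution.
Context {R : realType} (V C : lmodType R) (L : {linear C -> V}).
Variables (N : V -> R) (Q : C -> R).
Hypotheses (ND : forall x y, N (x + y) <= N x + N y)
  (NZ : forall (k : R) x, N (k *: x) = `|k| * N x)
  (QD : forall x y, Q (x + y) <= Q x + Q y)
  (QZ : forall (k : R) x, Q (k *: x) = `|k| * Q x).

(** The largest seminorm that is at most [N] everywhere and at most [Q c] at [L c]:
[C] parametrizes vectors that have to become small. *)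
Definition infconv (x : V) : R := inf [set N (x - L c) + Q c | c in [set: C]].

Let seminorm_ge0 (W : lmodType R) (M : W -> R)
  (MD : forall x y, M (x + y) <= M x + M y)
  (MZ : forall (k : R) x, M (k *: x) = `|k| * M x) x : 0 <= M x.
Proof.
have M0 : M 0 = 0 by rewrite -(scale0r x) MZ normr0 mul0r.
have := MD x (- x); rewrite subrr M0 -scaleN1r MZ normrN1 mul1r; lra.
Qed.

Lemma infconv_le x c : infconv x <= N (x - L c) + Q c.
Proof.
apply: ge_inf; last by exists c.
exists 0 => _ [d _ <-]; apply: addr_ge0; exact: seminorm_ge0.
Qed.

Lemma le_infconv r x : (forall c, r <= N (x - L c) + Q c) -> r <= infconv x.
Proof.
by move=> h; apply: lb_le_inf; [exists (N (x - L 0) + Q 0); exists 0|move=> _ [c _ <-]].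
Qed.

Lemma infconv_le_norm x : infconv x <= N x.
Proof.
have Q0 : Q 0 = 0 by rewrite -(scale0r 0) QZ normr0 mul0r.
by have := infconv_le x 0; rewrite linear0 subr0 Q0 addr0.
Qed.

Lemma infconv_le_link c : infconv (L c) <= Q c.
Proof.
have N0 : N 0 = 0 by rewrite -(scale0r 0) NZ normr0 mul0r.
by have := infconv_le (L c) c; rewrite subrr N0 add0r.
Qed.

Lemma infconvD x y : infconv (x + y) <= infconv x + infconv y.
Proof.
rewrite -lerBlDr; apply: le_infconv => c; rewrite lerBlDr -lerBlDl; apply: le_infconv => d.
rewrite lerBlDl; apply: (le_trans (infconv_le (x + y) (c + d))).
have -> : x + y - L (c + d) = (x - L c) + (y - L d).
  by rewrite linearD /= opprD addrACA.
have := ND (x - L c) (y - L d); have := QD c d; lra.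
Qed.

Lemma infconvZ k x : infconv (k *: x) = `|k| * infconv x.
Proof.
have N0 : N 0 = 0 by rewrite -(scale0r 0) NZ normr0 mul0r.
have g0 : infconv 0 = 0.
  apply/eqP; rewrite eq_le -{1}N0 infconv_le_norm /=; apply: le_infconv => c.
  apply: addr_ge0; exact: seminorm_ge0.
have le j y : infconv (j *: y) <= `|j| * infconv y.
  have [->|j0] := eqVneq j 0; first by rewrite scale0r normr0 mul0r g0.
  have j0' : 0 < `|j| by rewrite normr_gt0.
  rewrite mulrC -ler_pdivrMr //; apply: le_infconv => c; rewrite ler_pdivrMr //.
  apply: (le_trans (infconv_le _ (j *: c))).
  by rewrite linearZ /= -scalerBr NZ QZ mulrDl !(mulrC `|j|).
apply/eqP; rewrite eq_le le /=.
have [->|k0] := eqVneq k 0; first by rewrite scale0r normr0 mul0r g0.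
have := le k^-1 (k *: x); rewrite scalerA mulVf // scale1r normfV.
by rewrite mulrC ler_pdivlMr ?normr_gt0 // mulrC.
Qed.

End InfConvolution.

(** * Almost equal tuples and their amalgamation *)

Section RowVectors.
Context {R : realType}.

HB.instance Definition _ m n := Uniform_isComplete.Build 'M[R]_(m, n) cauchy_cvg.

(** Coefficients are functions on [nat], so that one function serves tuples of all
lengths; row vectors are used where a finite-dimensional space is required. *)
Definition coefs n (d : 'rV[R]_n) : nat -> R :=
  fun i => if insub i is Some j then d 0 j else 0.

Definition row_of n (c : nat -> R) : 'rV[R]_n := \row_(i < n) c i.

Lemma coefs_ord n (d : 'rV[R]_n) (i : 'I_n) : coefs d i = d 0 i.
Proof. by rewrite /coefs valK. Qed.

Lemma coefs_row_of n c i : coefs (row_of n c) i = trunc n c i.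
Proof.
rewrite /trunc; case: ifP => iln; first by rewrite -[i]/(nat_of_ord (Ordinal iln)) coefs_ord mxE.
by rewrite /coefs insubF.
Qed.

Lemma coefsP n k (d d' : 'rV[R]_n) : coefs (k *: d + d') = fun i => k * coefs d i + coefs d' i.
Proof.
apply/funext => i; rewrite /coefs; case: insubP => [j _ _|_]; first by rewrite !mxE.
by rewrite mulr0 addr0.
Qed.

Lemma coefsD n (d d' : 'rV[R]_n) : coefs (d + d') = fun i => coefs d i + coefs d' i.
Proof. by rewrite -[d]scale1r coefsP; apply/funext => i; rewrite mul1r scale1r. Qed.

Lemma coefs0 n : coefs (0 : 'rV[R]_n) = fun=> 0.
Proof. by apply/funext => i; rewrite /coefs; case: insubP => // j _ _; rewrite mxE. Qed.

Lemma coefsZ n k (d : 'rV[R]_n) : coefs (k *: d) = fun i => k * coefs d i.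
Proof. by rewrite -[k *: d]addr0 coefsP coefs0; apply/funext => i; rewrite addr0. Qed.

Lemma row_ofP n k (c c' : nat -> R) :
  row_of n (fun i => k * c i + c' i) = k *: row_of n c + row_of n c'.
Proof. by apply/rowP => i; rewrite !mxE. Qed.

Lemma coefsK n (d : 'rV[R]_n) : row_of n (coefs d) = d.
Proof. by apply/rowP => i; rewrite mxE coefs_ord. Qed.

Lemma comb_coefs_row_of (V : lmodType R) n c (v : nat -> V) :
  comb n (coefs (row_of n c)) v = comb n c v.
Proof. by apply: eq_comb => i iln; rewrite coefs_row_of /trunc iln. Qed.

Lemma comb_unit_rows n c :
  comb n c (fun k => row_of n (fun i => (i == k)%:R)) = row_of n c.
Proof.
apply/rowP => j; rewrite /comb summxE (bigD1 j) //= !mxE eqxx mulr1 big1 ?addr0 //.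
by move=> i; rewrite !mxE eq_sym -val_eqE /= => /negbTE ->; rewrite mulr0.
Qed.

Lemma l1_coefs_row_of n c : l1 n (coefs (row_of n c)) = l1 n c.
Proof. by apply: eq_l1 => i iln; rewrite coefs_row_of /trunc iln. Qed.

Lemma row_norm_le_l1 n (d : 'rV[R]_n) : `|d| <= l1 n (coefs d).
Proof.
rewrite [leLHS]/Num.norm /= mx_normrE; apply/bigmax_leP.
split=> [|[i j] _ /=]; first exact: l1_ge0.
by rewrite ord1 -coefs_ord; apply: l1_coef.
Qed.

Lemma l1_le_row_norm n (d : 'rV[R]_n) : l1 n (coefs d) <= n%:R * `|d|.
Proof.
have -> : n%:R * `|d| = \sum_(i < n) `|d|.
  by rewrite sumr_const card_ord mulr_natl.
apply: ler_sum => i _; rewrite coefs_ord [leRHS]/Num.norm /= mx_normrE.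
exact: (@le_bigmax _ _ _ 0 (fun ij : 'I_1 * 'I_n => `|d ij.1 ij.2|) (0, i)).
Qed.

End RowVectors.

Section Similar.
Context {R : realType} (S : normedModType R).

Definition nonexpansive (E F : normedModType R) (f : E -> F) :=
  forall x, `|f x| <= `|x|.

(** A seminorm on the first [n] coefficients. *)
Definition coef_gauge n (q : (nat -> R) -> R) : Prop :=
  [/\ forall c d, q (fun i => c i + d i) <= q c + q d,
      forall k c, q (fun i => k * c i) = `|k| * q c
    & forall c d, (forall i, (i < n)%N -> c i = d i) -> q c = q d].

Definition almost_eq (X Y : normedModType R) (T : X -> S) (T' : Y -> S) n q
    (a : nat -> X) (b : nat -> Y) : Prop :=
  forall c, `| `|comb n c a| - `|comb n c b| | <= q c /\
            `|T (comb n c a) - T' (comb n c b)| <= q c.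

Lemma gauge_ge0 n q c : coef_gauge n q -> 0 <= q c.
Proof.
case=> qD qZ _.
have q0 : q (fun=> 0) = 0.
  transitivity (q (fun i => 0 * c i)); last by rewrite qZ normr0 mul0r.
  by congr q; apply/funext => i; rewrite mul0r.
have := qD c (fun i => - 1 * c i); rewrite qZ normrN1 mul1r.
have -> : (fun i => c i + - 1 * c i) = fun=> 0 by apply/funext => i; rewrite mulN1r subrr.
rewrite q0; lra.
Qed.

Lemma gauge_l1 n r : 0 <= r -> coef_gauge n (fun c => r * l1 n c).
Proof.
move=> r0; split=> [c d|k c|c d h]; last by rewrite (eq_l1 h).
  by rewrite -mulrDr ler_wpM2l // l1D.
by rewrite l1Z mulrCA.
Qed.

Lemma gaugeD n q q' : coef_gauge n q -> coef_gauge n q' -> coef_gauge n (fun c => q c + q' c).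
Proof.
move=> [qD qZ qL] [q'D q'Z q'L]; split=> [c d|k c|c d h].
- have := qD c d; have := q'D c d; lra.
- by rewrite qZ q'Z mulrDr.
- by rewrite (qL _ _ h) (q'L _ _ h).
Qed.

Lemma almost_eq_sym (X Y : normedModType R) (T : X -> S) (T' : Y -> S) n q a b :
  almost_eq T T' n q a b -> almost_eq T' T n q b a.
Proof. by move=> h c; rewrite distrC (distrC (T' _)); exact: h. Qed.

End Similar.

Section Amalgam.
Context {R : realType} (S X Y : completeNormedModType R).
Variables (TX : {linear X -> S}) (TY : {linear Y -> S}).
Hypotheses (TX1 : nonexpansive TX) (TY1 : nonexpansive TY).
Variables (n m : nat) (nm : (n <= m)%N) (a : nat -> X) (b : nat -> Y).
Variables (q : (nat -> R) -> R) (gq : coef_gauge n q).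
Hypothesis sim : almost_eq TX TY n q a b.
Variables (delta : R) (delta0 : 0 < delta).

Let V : lmodType R := (X * 'rV[R]_m)%type.

Let rnorm (c : nat -> R) : R := `|comb m c b| + delta * l1 m c.

Let N (z : V) : R := `|z.1| + rnorm (coefs z.2).

Let Q (c : 'rV[R]_n) : R := q (coefs c) + (2 * delta) * l1 n (coefs c).

Let L0 (c : 'rV[R]_n) : V := (comb n (coefs c) a, - row_of m (coefs c)).

Let L0_linear : linear L0.
Proof.
move=> k c d; rewrite /L0 !coefsP row_ofP combD combZ.
by congr pair; rewrite /= opprD scalerN.
Qed.

Let L : {linear 'rV[R]_n -> V} :=
  HB.pack L0 (GRing.isLinear.Build R 'rV[R]_n V _ L0 L0_linear).

Let rnormD c d : rnorm (fun i => c i + d i) <= rnorm c + rnorm d.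
Proof.
rewrite /rnorm combD; have := ler_normD (comb m c b) (comb m d b).
have : delta * l1 m (fun i => c i + d i) <= delta * l1 m c + delta * l1 m d.
  by rewrite -mulrDr ler_wpM2l ?l1D // ltW.
lra.
Qed.

Let rnormZ k c : rnorm (fun i => k * c i) = `|k| * rnorm c.
Proof. by rewrite /rnorm combZ normrZ l1Z mulrDr mulrCA. Qed.

Let ND x y : N (x + y) <= N x + N y.
Proof.
rewrite /N /= coefsD; have := ler_normD x.1 y.1.
have := rnormD (coefs x.2) (coefs y.2); lra.
Qed.

Let NZ k x : N (k *: x) = `|k| * N x.
Proof. by rewrite /N /= coefsZ rnormZ normrZ -mulrDr. Qed.

Let QD c d : Q (c + d) <= Q c + Q d.
Proof.
have g := gaugeD gq (gauge_l1 n (ltW (mulr_gt0 (@ltr0n R 2) delta0))).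
by rewrite /Q coefsD; case: g => h _ _; exact: h.
Qed.

Let QZ k c : Q (k *: c) = `|k| * Q c.
Proof.
have g := gaugeD gq (gauge_l1 n (ltW (mulr_gt0 (@ltr0n R 2) delta0))).
by rewrite /Q coefsZ; case: g => _ h _; exact: h.
Qed.

Let p := infconv L N Q.

(** Comparison with the norm of the product gives definiteness and completeness. *)
Let p_equiv : exists K, [/\ 0 < K, forall z, `|z.1| + l1 m (coefs z.2) <= K * p z
  & forall z, p z <= K * (`|z.1| + `|z.2|)].
Proof.
have [M M0 aM] := tuple_bounded n a; have [B B0 bB] := tuple_bounded m b.
(* [K1] bounds the three losses: [x] and [d] against their translates by
   [L c], and the translation itself, which is paid for by [2 * delta * l1 n c]. *)
pose K1 := 1 + delta^-1 + (M + 1) / (2 * delta).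
pose K2 := 1 + (B + delta) * m%:R.
have d0 := delta0; have d20 : 0 < 2 * delta by lra.
have di : 0 < delta^-1 by rewrite invr_gt0.
have Md : 0 <= (M + 1) / (2 * delta) by rewrite divr_ge0 //; lra.
have K2ge : 1 <= K2 by rewrite lerDl mulr_ge0 // addr_ge0 // ltW.
have K1ge : 1 <= K1 by rewrite /K1; lra.
have K1d : 1 <= K1 * delta.
  have -> : K1 * delta = delta + 1 + (M + 1) / (2 * delta) * delta by rewrite /K1; field; lra.
  have := mulr_ge0 Md (ltW delta0); lra.
have K1M : M + 1 <= K1 * (2 * delta).
  have -> : K1 * (2 * delta) = 2 * delta + 2 + (M + 1) by rewrite /K1; field; lra.
  lra.
clearbody K1.
have Q0 c : (2 * delta) * l1 n (coefs c) <= Q c by rewrite /Q lerDr (gauge_ge0 _ gq).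
exists (K1 + K2); split; first lra.
  move=> z; suff h : (`|z.1| + l1 m (coefs z.2)) / K1 <= p z.
    have p0 : 0 <= p z.
      by apply: le_trans h; rewrite divr_ge0 ?addr_ge0 ?l1_ge0 //; lra.
    move: h; rewrite ler_pdivrMr; last lra.
    have := mulr_ge0 (le_trans ler01 K2ge) p0; lra.
  apply: le_infconv => c; rewrite ler_pdivrMr; last lra.
  case: z => x d /=; rewrite /N /=.
  have -> : d - - row_of m (coefs c) = d + row_of m (coefs c) by rewrite opprK.
  set x' := x - _; set d' := d + _; set C := l1 n (coefs c).
  have hx : `|x| <= `|x'| + M * C.
    have -> : x = x' + comb n (coefs c) a by rewrite /x' subrK.
    apply: (le_trans (ler_normD _ _)); rewrite lerD2l; exact: norm_comb_le.
  have hd : l1 m (coefs d) <= l1 m (coefs d') + C.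
    have -> : d = d' + (- 1) *: row_of m (coefs c) by rewrite /d' scaleN1r addrK.
    rewrite coefsD; apply: (le_trans (l1D _ _ _)); rewrite lerD2l coefsZ l1Z normrN1 mul1r.
    rewrite l1_coefs_row_of /C -(l1_trunc (coefs c) nm) le_eqVlt; apply/orP; left; apply/eqP.
    apply: eq_l1 => i _; rewrite /trunc; case: ifP => // iln.
    by rewrite /coefs insubF.
  have h1 : `|x'| <= K1 * `|x'| by rewrite ler_peMl.
  have h2 : l1 m (coefs d') <= (K1 * delta) * l1 m (coefs d') by rewrite ler_peMl ?l1_ge0.
  have h3 : (M + 1) * C <= (K1 * (2 * delta)) * C by rewrite ler_wpM2r // l1_ge0.
  have h4 : K1 * ((2 * delta) * C) <= K1 * Q c by rewrite ler_wpM2l ?Q0 //; lra.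
  have h5 : 0 <= K1 * `|comb m (coefs d') b| by rewrite mulr_ge0 //; lra.
  rewrite /rnorm; lra.
move=> z; apply: (le_trans (infconv_le_norm L ND NZ QD QZ z)); rewrite /N /rnorm.
have h1 : `|comb m (coefs z.2) b| <= B * l1 m (coefs z.2) by exact: norm_comb_le.
have h2 : (B + delta) * l1 m (coefs z.2) <= (B + delta) * (m%:R * `|z.2|).
  by rewrite ler_wpM2l ?l1_le_row_norm //; lra.
have h3 := normr_ge0 z.1; have h4 := normr_ge0 z.2.
have h5 : `|z.1| <= (K1 + K2) * `|z.1| by rewrite ler_peMl //; lra.
have h6 : 0 <= (K1 + 1) * `|z.2| by rewrite mulr_ge0 //; lra.
move: h5 h6; rewrite /K2; lra.
Qed.

Let p_eq0 z : p z = 0 -> z = 0.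
Proof.
have [K [K0 h _]] := p_equiv => pz; have := h z; rewrite pz mulr0.
case: z {pz} => x d /= xd.
have x0 : `|x| = 0.
  by apply/eqP; rewrite eq_le normr_ge0 andbT; have := l1_ge0 m (coefs d); lra.
have d0 : `|d| = 0.
  apply/eqP; rewrite eq_le normr_ge0 andbT; have := row_norm_le_l1 d.
  have := normr_ge0 x; lra.
by rewrite (normr0_eq0 x0) (normr0_eq0 d0).
Qed.

Let p_complete v : cauchy_in p v -> exists l, limit_in p v l.
Proof.
have [K [K0 lo hi]] := p_equiv => cv.
have [x hx] : exists x, limit_in Num.norm (fun k => (v k).1) x.
  apply: banach_complete; apply: cauchy_le K0 _ cv => k k'.
  apply: le_trans (lo _); rewrite /= lerDl; exact: l1_ge0.
have [d hd] : exists d : 'rV[R]_m, limit_in Num.norm (fun k => (v k).2) d.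
  apply: (@banach_complete R 'rV[R]_m); apply: cauchy_le K0 _ cv => k k'.
  apply: le_trans (lo _); apply: (le_trans (row_norm_le_l1 _)).
  by rewrite lerDr.
exists (x, d) => e e0.
have e' : 0 < e / (2 * K) by rewrite divr_gt0 // mulr_gt0.
have [N1 h1] := hx _ e'; have [N2 h2] := hd _ e'.
exists (maxn N1 N2) => k; rewrite geq_max => /andP[k1 k2].
apply: (le_lt_trans (hi _)); rewrite mulrC -ltr_pdivlMr //.
have -> : e / K = e / (2 * K) + e / (2 * K) by field; lra.
by apply: ltrD; [exact: h1|exact: h2].
Qed.

Let P : banach_norm V :=
  BanachNorm (infconvD L ND NZ QD QZ) (infconvZ L ND NZ QD QZ) p_eq0 p_complete.

Let Z : completeNormedModType R := normed_by P.

Let coefs_high (c : 'rV[R]_n) : trunc n (coefs c) = coefs c.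
Proof.
by apply/funext => i; rewrite /trunc; case: ifP => // iln; rewrite /coefs insubF.
Qed.

Let comb_row (W : lmodType R) (c : 'rV[R]_n) (w : nat -> W) :
  comb m (coefs (row_of m (coefs c))) w = comb n (coefs c) w.
Proof. by rewrite comb_coefs_row_of -(comb_trunc _ _ nm) coefs_high. Qed.

Let l1_row (c : 'rV[R]_n) : l1 m (coefs (row_of m (coefs c))) = l1 n (coefs c).
Proof. by rewrite l1_coefs_row_of -(l1_trunc _ nm) coefs_high. Qed.

(** The space is [X * 'rV_m] with the largest seminorm that restricts to at most the
given norms on the factors and puts the combinations of [a] and [b] with
coefficients [c] at distance at most [q c + 2 * delta * l1 n c].  Almost equality
says exactly that this identification shortens no vector of either factor and
that the sum of the two operators keeps norm at most one.  The terms in [delta]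
turn the seminorm into a norm, at the cost of replacing [b] by an independent
tuple whose norms are larger by [delta * l1 m c]. *)
Lemma amalgam_exists : exists (Z : completeNormedModType R)
    (TZ : {linear Z -> S}) (i : {linear X -> Z}) (v : nat -> Z),
  [/\ nonexpansive TZ, forall x, `|i x| = `|x|, forall x, TZ (i x) = TX x,
      forall z, exists x c, z = i x + comb m c v
    & [/\ forall c, `|comb m c v| = `|comb m c b| + delta * l1 m c,
          forall c, TZ (comb m c v) = TY (comb m c b)
        & forall c, `|comb n c v - i (comb n c a)| <= q c + (2 * delta) * l1 n c]].
Proof.
have [TZ TZE] : exists TZ : {linear Z -> S},
    TZ =1 fun z => TX z.1 + TY (comb m (coefs z.2) b).
  apply: linear_exists => k z z' /=; rewrite coefsP combD combZ !linearP /=.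
  by rewrite scalerDr addrACA.
have [i iE] : exists i : {linear X -> Z}, i =1 fun x => (x, 0).
  by apply: linear_exists => k x x'; congr pair; rewrite /= scaler0 addr0.
have [w wE] : exists w : {linear 'rV[R]_m -> Z}, w =1 fun d => (0, d).
  by apply: linear_exists => k d d'; congr pair; rewrite /= scaler0 addr0.
pose v k := w (row_of m (fun i => (i == k)%:R)).
have vE c : comb m c v = (0, row_of m c) :> V.
  by rewrite -(linear_comb w) comb_unit_rows wE.
have coefs_row c : row_of m (coefs (row_of m c)) = row_of m c by rewrite coefsK.
have normE (x : V) : `|x : Z| = p x by [].
exists Z, TZ, i, v; split.
- move=> z; rewrite TZE normE; apply: le_infconv => c.
  have [h1 h2] := sim (coefs c).
  set x' := z - L c; have zE : z = x' + L c by rewrite /x' subrK.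
  clearbody x'.
  rewrite zE /= coefsD combD !linearD /=.
  have -> : comb m (coefs (- row_of m (coefs c))) b = - comb n (coefs c) b.
    by rewrite -(scaleN1r (row_of _ _)) coefsZ combZ comb_row scaleN1r.
  rewrite [TY (- _)]linearN /= addrACA; apply: (le_trans (ler_normD _ _)).
  apply: lerD; last first.
    by apply: (le_trans h2); rewrite /Q lerDl !mulr_ge0 ?l1_ge0 // ltW.
  apply: (le_trans (ler_normD _ _)); rewrite /N; apply: lerD; first exact: TX1.
  apply: (le_trans (TY1 _)); by rewrite /rnorm lerDl mulr_ge0 ?l1_ge0 // ltW.
- move=> x; rewrite iE normE; apply/eqP; rewrite eq_le; apply/andP; split.
    apply: (le_trans (infconv_le_norm L ND NZ QD QZ _)).
    rewrite /N /rnorm /= coefs0 comb_const0 normr0.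
    by rewrite /l1 big1 ?mulr0 ?addr0 // => j _; rewrite normr0.
  apply: le_infconv => c; have [h1 h2] := sim (coefs c).
  rewrite /N /rnorm /= sub0r opprK comb_row l1_row /Q.
  set A := comb n (coefs c) a; have := ler_normD (x - A) A; rewrite subrK => h3.
  move: h1; rewrite -/A ler_norml => /andP[_ h1].
  have := mulr_ge0 (ltW delta0) (l1_ge0 n (coefs c)); lra.
- by move=> x; rewrite TZE iE /= coefs0 comb_const0 linear0 addr0.
- move=> z; exists z.1, (coefs z.2); rewrite iE vE coefsK /=.
  case: z => x d; congr pair; rewrite /= ?addr0 ?add0r //.
split.
- move=> c; rewrite vE normE; apply/eqP; rewrite eq_le; apply/andP; split.
    apply: (le_trans (infconv_le_norm L ND NZ QD QZ _)).
    by rewrite /N /rnorm /= normr0 add0r comb_coefs_row_of l1_coefs_row_of.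
  apply: le_infconv => d; have [h1 h2] := sim (coefs d).
  rewrite /N /rnorm /= sub0r normrN opprK coefsD combD.
  rewrite comb_coefs_row_of comb_row /Q.
  set A := comb n (coefs d) a; set B := comb n (coefs d) b; set C := comb m c b.
  have := ler_normB (C + B) B; rewrite addrK => h3.
  move: h1; rewrite -/A -/B ler_norml => /andP[h1 _].
  set cd := (fun i => coefs (row_of m c) i + _).
  have : delta * l1 m c <= delta * l1 m cd + delta * l1 n (coefs d).
    rewrite -mulrDr ler_wpM2l ?(ltW delta0) // -l1_row.
    have -> : l1 m c = l1 m (fun i => cd i + - 1 * coefs (row_of m (coefs d)) i).
      apply: eq_l1 => j jm; rewrite /cd /= !coefs_row_of /trunc jm. by rewrite mulN1r addrK.
    by apply: (le_trans (l1D _ _ _)); rewrite l1Z normrN1 mul1r.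
  have := mulr_ge0 (ltW delta0) (l1_ge0 n (coefs d)); lra.
- move=> c; rewrite TZE vE /= linear0 add0r comb_coefs_row_of //.
- move=> c; rewrite -(comb_trunc _ _ nm) vE iE -normrN normE opprB.
  have -> : (comb n c a, 0) - (0, row_of m (trunc n c)) = L (row_of n c) :> V.
    rewrite /L /= /L0; congr pair; rewrite /= ?subr0 ?comb_coefs_row_of //.
    rewrite sub0r; congr (- _); apply/rowP => j; rewrite !mxE coefs_row_of //.
  apply: (le_trans (infconv_le_link L ND NZ QD QZ _)); rewrite /Q l1_coefs_row_of.
  case: gq => _ _ gl; rewrite (gl _ c) // => j jn.
  by rewrite coefs_row_of /trunc jn.
Qed.

End Amalgam.

(** * Extending almost equal tuples by one vector *)

Section OperatorNorm.
Context {R : realType}.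
Implicit Types E F : completeNormedModType R.

Lemma opnorm_on_ge E F (A : set E) (f : E -> F) x : A x -> `|x| <= 1 ->
  (`|f x|%:E <= opnorm_on A f)%E.
Proof. by move=> Ax x1; apply: ereal_sup_ubound; exists x. Qed.

(** On a set stable under scaling, a strict bound on the supremum over the unit ball
leaves room for a smaller constant, valid at vectors of all lengths. *)
Lemma opnorm_on_lt E F (A : set E) (f : E -> F) (e : R) : A 0 ->
  (forall k x, A x -> A (k *: x) /\ f (k *: x) = k *: f x) ->
  (opnorm_on A f < e%:E)%E ->
  exists e', [/\ 0 <= e', e' < e & forall x, A x -> `|f x| <= e' * `|x|].
Proof.
move=> A0 hom; have := opnorm_on_ge f A0; rewrite normr0 => /(_ ler01).
have ub := @opnorm_on_ge _ _ A f; case: (opnorm_on A f) ub => [s| |] // ub s0 se.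
exists s; split=> [||x Ax]; first by rewrite -lee_fin (le_trans _ s0) // lee_fin.
  by rewrite -lte_fin.
have [->|x0] := eqVneq x 0.
  by rewrite -(scale0r 0) (hom 0 0 A0).2 !scale0r !normr0 mulr0.
have nx : 0 < `|x| by rewrite normr_gt0.
have [Ay fy] := hom `|x|^-1 x Ax.
have := ub _ Ay; rewrite fy !normrZ normfV normr_id mulVf ?gt_eqF // lexx.
by move=> /(_ isT); rewrite lee_fin mulrC ler_pdivrMr.
Qed.

Lemma lt_opnorm_on E F (A : set E) (f : E -> F) (e' e : R) : 0 <= e' -> e' < e ->
  (forall x, A x -> `|f x| <= e' * `|x|) -> (opnorm_on A f < e%:E)%E.
Proof.
move=> e0 ee h; apply: (@le_lt_trans _ _ e'%:E); last by rewrite lte_fin.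
apply: ge_ereal_sup => _ [x [Ax x1] <-]; rewrite lee_fin (le_trans (h _ Ax)) //.
by rewrite ler_piMr.
Qed.

Lemma opnorm_le1 E F (f : {linear E -> F}) : (opnorm f <= 1)%E <-> nonexpansive f.
Proof.
split=> [f1 x|f1]; last first.
  by apply: ge_ereal_sup => _ [x [_ x1] <-]; rewrite lee_fin (le_trans (f1 x)).
apply/ler_addgt0Pr => e e0.
have [|||s [s0 se h]] := @opnorm_on_lt _ _ [set: E] f (1 + e / (`|x| + 1)) => //.
- by move=> k y _; rewrite linearZ.
- by apply: (le_lt_trans f1); rewrite lte_fin ltrDl divr_gt0 // ltr_wpDl.
apply: (le_trans (h x I)); have x1 : 0 < `|x| + 1 by rewrite ltr_wpDl.
apply: (@le_trans _ _ ((1 + e / (`|x| + 1)) * `|x|)); first by rewrite ler_wpM2r // ltW.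
rewrite mulrDl mul1r lerD2l mulrAC ler_pdivrMr //.
by rewrite ler_wpM2l ?lerDl // ltW.
Qed.

Lemma opnorm_lt E F (f g : {linear E -> F}) (e : R) :
  (opnorm (fun x => f x - g x)%R < e%:E)%E -> forall x, `|f x - g x| <= e * `|x|.
Proof.
move=> fg; have [||| e' [_ e'e h] x] := @opnorm_on_lt _ _ setT (fun x => f x - g x) e => //.
  by move=> k x _; split=> //; rewrite scalerBr !linearZ.
by rewrite (le_trans (h x I)) // ler_wpM2r // ltW.
Qed.

Lemma fin_dim_subspaceP E (A : set E) : fin_dim_subspace A <->
  exists n (b : nat -> E), forall x, A x <-> exists c, x = comb n c b.
Proof.
split=> [[n [b ->]]|[n [b h]]].
  exists n, (fun i => if insub i is Some j then b j else 0) => x; split=> -[c ->].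
    exists (fun i => if insub i is Some j then c j else 0).
    by apply: eq_bigr => i _; rewrite !valK.
  exists (fun i => c i); apply: eq_bigr => i _; rewrite !valK //.
exists n, (fun i => b i); apply/seteqP; split=> x /=.
  by move=> /h[c ->]; exists (fun i => c i).
move=> [c ->]; apply/h; exists (fun i => if insub i is Some j then c j else 0).
by apply: eq_bigr => i _; rewrite !valK.
Qed.

Lemma comb_cat (V : lmodType R) n m c (v w : nat -> V) :
  comb (n + m) c (fun i => if (i < n)%N then v i else w (i - n)%N) =
  comb n c v + comb m (fun i => c (n + i)%N) w.
Proof.
rewrite /comb big_split_ord; congr (_ + _); apply: eq_bigr => i _ /=.
  by rewrite ltn_ord.
by rewrite ltnNge leq_addr /= addKn.
Qed.

Lemma finite_dimensional_span E F (f : {linear E -> F}) m (v : nat -> F) :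
  finite_dimensional E -> (forall z, exists x c, z = f x + comb m c v) ->
  finite_dimensional F.
Proof.
move=> /fin_dim_subspaceP[n [b hb]] h; apply/fin_dim_subspaceP.
exists (n + m)%N, (fun i => if (i < n)%N then f (b i) else v (i - n)%N).
move=> z; split=> // _; have [x [c ->]] := h z.
have [d ->] := (hb x).1 I.
exists (fun i => if (i < n)%N then d i else c (i - n)%N).
rewrite (comb_cat n m _ (f \o b)) linear_comb; congr (_ + _).
  by apply: eq_comb => i ilt; rewrite ilt.
by apply: eq_comb => i _; rewrite ltnNge leq_addr /= addKn.
Qed.

Lemma dense_approx E (D : set E) x (e : R) : dense D -> 0 < e ->
  exists y, D y /\ `|x - y| < e.
Proof.
move=> dD e0; have [] := dD (ball x e).
- by exists x; exact: ballxx.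
- exact: ball_open.
by move=> y []; rewrite -ball_normE /= => xy Dy; exists y.
Qed.

End OperatorNorm.

Section Extendable.
Context {R : realType} (S : completeNormedModType R).

(** Tuples at distance [q] in one space are almost equal with error [q], and by
amalgamation the converse holds; so the old entries have to move by about [q]. *)
Definition extendable (G : completeNormedModType R) (U : {linear G -> S}) : Prop :=
  forall (Y : completeNormedModType R) (T : {linear Y -> S}), nonexpansive T ->
  forall n q (a : nat -> G) (b : nat -> Y), coef_gauge n q -> almost_eq U T n q a b ->
  forall delta : R, 0 < delta ->
  exists a' : nat -> G,
    almost_eq U T n.+1 (fun c => delta * l1 n.+1 c) a' b /\
    forall c, `|comb n c a' - comb n c a| <= q c + delta * l1 n c.

(** The arrows [j] and [i] of the infimum preserve norms and operators exactly, and
[j \o f] is close to [i]; so [f] preserves both up to the distance. *)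
Lemma mu_lt (x y : Kobj S) (f : {linear x -> y}) (e : R) : (mu f < e%:E)%E ->
  forall z, `| `|f z| - `|z| | <= e * `|z| /\
            `|Kop y (f z) - Kop x z| <= e * `|z|.
Proof.
move=> /ereal_inf_lt[_ [w [j [i [[jiso jop] [iiso iop] ->]]]]].
rewrite /rho => h z.
have {}h := opnorm_lt (f := j \o f) h z.
rewrite -(jiso (f z) I) -(iiso z I) -jop -iop -linearB /=; split.
  by apply: (le_trans (ler_dist_dist _ _)) ; rewrite iiso.
rewrite iiso //; apply: le_trans h.
by have /opnorm_le1 -> := Kop_le1 w.
Qed.

Section FraisseExtendable.
Variables (u : heart_seq S) (Au : Fraisse_A u).
Variables (G : completeNormedModType R) (iota : forall n, {linear u n -> G}).
Hypothesis Gu : completed_union iota.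
Variables (U : {linear G -> S}) (bU : bounded_near U (nbhs 0)).
Hypothesis Uu : forall n z, U (iota n z) = Kop (u n) z.

(** The bound holds on the dense union, and a bounded operator is continuous. *)
Lemma limit_operator_nonexpansive : nonexpansive U.
Proof.
have [iiso _ dG] := Gu.
have /linear_boundedP[M [Mr hM]] := bU.
have {}hM : exists K, 0 < K /\ forall x, `|U x| <= K * `|x|.
  exists (`|M| + 1); split; first by rewrite ltr_wpDl.
  by apply: hM; rewrite (le_lt_trans (ler_norm _)) // ltrDl.
have [K [K0 hK]] := hM => x; apply/ler_addgt0Pr => e e0.
have K1 : 0 < K + 1 by rewrite addr_gt0.
have [_ [[n _ [z _ <-]] xz]] := dense_approx x dG (divr_gt0 e0 K1).
have -> : U x = U (x - iota n z) + U (iota n z) by rewrite -linearD subrK.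
apply: (le_trans (ler_normD _ _)); rewrite Uu.
have h1 := hK (x - iota n z).
have h2 : `|Kop (u n) z| <= `|z| by have /opnorm_le1 -> := Kop_le1 (u n).
have h3 : `|z| <= `|x| + `|x - iota n z|.
  by rewrite -(iiso n z I) -{1}(subrK x (iota n z)) addrC distrC ler_normD.
move: xz; rewrite ltr_pdivlMr // => xz.
by move: h1 h2 h3 xz; set t := `|x - _|; lra.
Qed.

Lemma approx_tuple n (a : nat -> G) (eta : R) : 0 < eta ->
  exists N (alpha : nat -> u N), forall i, (i < n)%N -> `|iota N (alpha i) - a i| <= eta.
Proof.
have [_ ibond dG] := Gu; move=> eta0; elim: n => [|n [N [alpha h]]].
  by exists 0%N, (fun=> 0).
have [_ [[M _ [z _ <-]] xz]] := dense_approx (a n) dG eta0.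
pose K := maxn N M.
exists K, (update (bond u (leq_maxl N M) \o alpha) n (bond u (leq_maxr N M) z)).
move=> i; rewrite ltnS /update /= leq_eqVlt; case: eqP => [-> _|_ /= /h].
  by rewrite ibond distrC ltW.
by rewrite ibond.
Qed.

(** Move [a] into some [u N], amalgamate [u N] with [Y], and let [Fraisse_A] map the
amalgam to a later member of the sequence: the image of the tuple of the
amalgam that stands for [b] is the new tuple. *)
Lemma Fraisse_extendable : extendable U.
Proof.
move=> Y T T1 n q a b gq sim delta delta0.
have [iiso ibond _] := Gu; have U1 := limit_operator_nonexpansive.
have [Ma Ma0 aM] := tuple_bounded n a; have [Mb Mb0 bM] := tuple_bounded n.+1 b.
pose eta := delta / 8; have eta0 : 0 < eta by rewrite divr_gt0.
pose M := Ma + Mb + eta + 1; have M0 : 0 < M by rewrite /M; lra.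
(* The errors of the arrow given by [Fraisse_A] are proportional to norms of vectors;
   [M] bounds these norms by multiples of [l1]. *)
pose e := delta / (8 * M).
have e0 : 0 < e by rewrite divr_gt0 // mulr_gt0.
have eM : e * M = delta / 8 by rewrite /e; field; lra.
have [N [alpha ha]] := approx_tuple n a eta0.
have close c : `|iota N (comb n c alpha) - comb n c a| <= eta * l1 n c.
  by rewrite linear_comb combBr; apply: norm_comb_le.
pose q1 c := q c + eta * l1 n c.
have gq1 : coef_gauge n q1 by apply: gaugeD => //; apply: gauge_l1; exact: ltW.
have sim1 : almost_eq (Kop (u N)) T n q1 alpha b.
  move=> c; have [h1 h2] := sim c; have h3 := close c.
  rewrite -(iiso N (comb n c alpha) I) -Uu; split.
    apply: (le_trans (ler_distD `|comb n c a| _ _)); rewrite addrC; apply: lerD => //.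
    exact: le_trans (ler_dist_dist _ _) h3.
  apply: (le_trans (ler_distD (U (comb n c a)) _ _)); rewrite addrC; apply: lerD => //.
  by rewrite -linearB; exact: le_trans (U1 _) h3.
have K1 : nonexpansive (Kop (u N)) by have /opnorm_le1 := Kop_le1 (u N).
have [Z [TZ [i [v [TZ1 iiso' iop spanZ [vnorm vop vclose]]]]]] :=
  amalgam_exists K1 T1 (leqnSn n) gq1 sim1 eta0.
have Zfin : finite_dimensional Z := finite_dimensional_span (Kspace_fin (u N)) spanZ.
pose y := MkKobj Zfin ((opnorm_le1 TZ).2 TZ1).
have hi : heart_arrow (i : {linear u N -> y}) by split=> [x _|]; [exact: iiso'|exact: iop].
have [m [Nm [g [gK gmu grho]]]] := Au e0 hi.
have gmu' := mu_lt gmu.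
have g1 : nonexpansive g by exact/opnorm_le1.
have grho' := opnorm_lt (g := g \o i) grho.
pose a' k := iota m (g (v k)).
have a'E k c : comb k c a' = iota m (g (comb k c v)) by rewrite !linear_comb.
have vM c : `|comb n.+1 c v| <= M * l1 n.+1 c.
  rewrite vnorm; have h1 : `|comb n.+1 c b| <= Mb * l1 n.+1 c by exact: norm_comb_le.
  have h2 : 0 <= (Ma + 1) * l1 n.+1 c by rewrite mulr_ge0 ?l1_ge0 //; lra.
  rewrite /M; lra.
exists a'; split=> c.
  rewrite a'E; have [h1 h2] := gmu' (comb n.+1 c v).
  have h3 : e * `|comb n.+1 c v| <= delta / 8 * l1 n.+1 c.
    by rewrite -eM -mulrA ler_wpM2l ?vM // ltW.
  have h4 : 0 <= delta * l1 n.+1 c by rewrite mulr_ge0 ?l1_ge0 // ltW.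
  split; last by rewrite Uu -vop; apply: (le_trans h2); lra.
  rewrite iiso //; apply: (le_trans (ler_distD `|comb n.+1 c v| _ _)).
  have -> : `| `|comb n.+1 c v| - `|comb n.+1 c b| | = eta * l1 n.+1 c.
    by rewrite vnorm addrAC subrr add0r ger0_norm // mulr_ge0 ?l1_ge0 // ltW.
  apply: (le_trans (lerD h1 (lexx _))); rewrite /eta; lra.
rewrite a'E; set w := comb n c alpha.
have wM : e * `|w| <= delta / 8 * l1 n c.
  rewrite -eM -mulrA ler_wpM2l ?(ltW e0) // -(iiso N w I).
  have h1 : `|comb n c a| <= Ma * l1 n c by exact: norm_comb_le.
  have h2 : 0 <= (Mb + 1) * l1 n c by rewrite mulr_ge0 ?l1_ge0 //; lra.
  have := close c; rewrite -/w => h3.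
  have := ler_normD (iota N w - comb n c a) (comb n c a); rewrite subrK /M; lra.
have h1 : `|g (comb n c v) - g (i w)| <= q c + 3 * (eta * l1 n c).
  rewrite -linearB; apply: (le_trans (g1 _)); apply: (le_trans (vclose c)).
  rewrite /q1; lra.
have h2 := grho' w.
have h3 := close c; rewrite -/w -(ibond _ _ (ltnW Nm)) in h3.
apply: (le_trans (ler_distD (iota m (bond u (ltnW Nm) w)) _ _)).
have h4 : `|iota m (g (comb n c v)) - iota m (bond u (ltnW Nm) w)| <=
    `|g (comb n c v) - g (i w)| + e * `|w|.
  rewrite -linearB iiso //; apply: (le_trans (ler_distD (g (i w)) _ _)).
  by rewrite lerD2l distrC.
have h5 : 0 <= delta * l1 n c by rewrite mulr_ge0 ?l1_ge0 // ltW.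
move: h1 h3 h4 wM; rewrite /eta; lra.
Qed.

End FraisseExtendable.

End Extendable.

(** * Linear isometries obtained as limits *)

Section LimitTuples.
Context {R : realType} (S : completeNormedModType R).

Lemma eq0_of_half_pow (x r : R) : 0 <= x -> (forall k, exists2 n, (k <= n)%N & x <= r / 2 ^+ n) -> x = 0.
Proof.
move=> x0 h; apply/eqP; rewrite eq_le x0 andbT; apply/ler_addgt0Pr => e e0.
have [k hk] := half_pow_lt r e0; have [n kn xn] := h k.
by rewrite add0r (le_trans xn) // ltW // hk.
Qed.

(** [N k] is the length of the tuples at stage [k].  From the stage where it appears,
each entry moves by at most [r / 2 ^+ k]; the limits inherit the almost equalities
of all stages, whose errors tend to zero. *)
Lemma limit_tuples (X Y : completeNormedModType R)
    (TX : {linear X -> S}) (TY : {linear Y -> S})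
    (N : nat -> nat) (r : R) (a : nat -> nat -> X) (b : nat -> nat -> Y) :
  nonexpansive TX -> nonexpansive TY ->
  {homo N : i j / (i <= j)%N} -> (forall k, (k <= N k)%N) -> 0 <= r ->
  (forall k, almost_eq TX TY (N k) (fun c => r / 2 ^+ k * l1 (N k) c) (a k) (b k)) ->
  (forall k i, (i < N k)%N -> `|a k.+1 i - a k i| <= r / 2 ^+ k) ->
  (forall k i, (i < N k)%N -> `|b k.+1 i - b k i| <= r / 2 ^+ k) ->
  exists (a' : nat -> X) (b' : nat -> Y),
  [/\ forall k i, (i < N k)%N -> `|a' i - a k i| <= 2 * r / 2 ^+ k,
      forall k i, (i < N k)%N -> `|b' i - b k i| <= 2 * r / 2 ^+ k,
      forall n c, `|comb n c a'| = `|comb n c b'|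
    & forall n c, TX (comb n c a') = TY (comb n c b')].
Proof.
move=> TX1 TY1 Nmono Nk r0 sim ha hb.
have first i : exists K, (i < N K)%N /\ forall k, (i < N k)%N -> (K <= k)%N.
  have exN : exists k, (i < N k)%N by exists i.+1; exact: Nk.
  by exists (ex_minn exN); case: ex_minnP.
have [a' a'P] : {a' : nat -> X & forall i k, (i < N k)%N -> `|a' i - a k i| <= 2 * r / 2 ^+ k}.
  apply: (@choice _ _ (fun i l => forall k, (i < N k)%N -> `|l - a k i| <= 2 * r / 2 ^+ k)) => i.
  have [K [iK Kmin]] := first i.
  have [l hl] := @geometric_limit _ _ (fun k => a k i) K r
    (fun k kK => ha k i (leq_trans iK (Nmono _ _ kK))).
  by exists l => k ik; apply: hl; exact: Kmin.
have [b' b'P] : {b' : nat -> Y & forall i k, (i < N k)%N -> `|b' i - b k i| <= 2 * r / 2 ^+ k}.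
  apply: (@choice _ _ (fun i l => forall k, (i < N k)%N -> `|l - b k i| <= 2 * r / 2 ^+ k)) => i.
  have [K [iK Kmin]] := first i.
  have [l hl] := @geometric_limit _ _ (fun k => b k i) K r
    (fun k kK => hb k i (leq_trans iK (Nmono _ _ kK))).
  by exists l => k ik; apply: hl; exact: Kmin.
exists a', b'; split=> [k i|k i|n c|n c]; [exact: a'P|exact: b'P| |].
  apply/eqP; rewrite -subr_eq0 -normr_eq0; apply/eqP.
  apply: (@eq0_of_half_pow _ (5 * r * l1 n c)) => // k0.
  pose k := maxn k0 n; exists k; first exact: leq_maxl.
  have nN : (n <= N k)%N by apply: leq_trans (Nk k); exact: leq_maxr.
  have [h _] := sim k (trunc n c).
  rewrite !comb_trunc // l1_trunc // in h.
  have h1 : `|comb n c a' - comb n c (a k)| <= 2 * r / 2 ^+ k * l1 n c.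
    rewrite combBr; apply: norm_comb_le => i ilt; apply: a'P; exact: leq_trans nN.
  have h2 : `|comb n c b' - comb n c (b k)| <= 2 * r / 2 ^+ k * l1 n c.
    rewrite combBr; apply: norm_comb_le => i ilt; apply: b'P; exact: leq_trans nN.
  have h3 := le_trans (ler_dist_dist _ _) h1; have h4 := le_trans (ler_dist_dist _ _) h2.
  apply: (le_trans (ler_distD `|comb n c (a k)| _ _)).
  have := ler_distD `|comb n c (b k)| `|comb n c (a k)| `|comb n c b'|.
  rewrite (distrC `|comb n c (b k)| `|comb n c b'|) => h5.
  have -> : 5 * r * l1 n c / 2 ^+ k =
      2 * r / 2 ^+ k * l1 n c + r / 2 ^+ k * l1 n c + 2 * r / 2 ^+ k * l1 n c by ring.
  lra.
apply/eqP; rewrite -subr_eq0 -normr_eq0; apply/eqP.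
apply: (@eq0_of_half_pow _ (5 * r * l1 n c)) => // k0.
pose k := maxn k0 n; exists k; first exact: leq_maxl.
have nN : (n <= N k)%N by apply: leq_trans (Nk k); exact: leq_maxr.
have [_ h] := sim k (trunc n c).
rewrite !comb_trunc // l1_trunc // in h.
have h1 : `|TX (comb n c a') - TX (comb n c (a k))| <= 2 * r / 2 ^+ k * l1 n c.
  rewrite -linearB (le_trans (TX1 _)) // combBr.
  by apply: norm_comb_le => i ilt; apply: a'P; exact: leq_trans nN.
have h2 : `|TY (comb n c b') - TY (comb n c (b k))| <= 2 * r / 2 ^+ k * l1 n c.
  rewrite -linearB (le_trans (TY1 _)) // combBr.
  by apply: norm_comb_le => i ilt; apply: b'P; exact: leq_trans nN.
apply: (le_trans (ler_distD (TX (comb n c (a k))) _ _)).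
have := ler_distD (TY (comb n c (b k))) (TX (comb n c (a k))) (TY (comb n c b')).
rewrite (distrC (TY (comb n c (b k))) (TY (comb n c b'))) => h5.
have -> : 5 * r * l1 n c / 2 ^+ k =
      2 * r / 2 ^+ k * l1 n c + r / 2 ^+ k * l1 n c + 2 * r / 2 ^+ k * l1 n c by ring.
lra.
Qed.

(** The graph of the isometry is the set of pairs that are simultaneously
approximated by [(A p, B p)]: it is total by completeness, and functional and
linear because equal norms pass to the limit. *)
Lemma isometry_extension (P : lmodType R) (X Y : completeNormedModType R)
    (A : {linear P -> X}) (B : {linear P -> Y}) :
  (forall p, `|A p| = `|B p|) ->
  (forall x e, 0 < e -> exists p, `|x - A p| < e) ->
  exists h : {linear X -> Y}, (forall x, `|h x| = `|x|) /\ forall p, h (A p) = B p.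
Proof.
move=> AB dA.
pose rel x y := forall e, 0 < e -> exists p, `|x - A p| < e /\ `|y - B p| < e.
have relP k x y x' y' : rel x y -> rel x' y' -> rel (k *: x + x') (k *: y + y').
  move=> h h' e e0; have k0 : 0 < `|k| + 1 by rewrite ltr_wpDl.
  have [p [xp yp]] := h _ (divr_gt0 e0 (mulr_gt0 (@ltr0n R 2) k0)).
  have [p' [xp' yp']] := h' _ (divr_gt0 e0 (@ltr0n R 2)).
  have aux (W : completeNormedModType R) (C : {linear P -> W}) w w' :
      `|w - C p| < e / (2 * (`|k| + 1)) -> `|w' - C p'| < e / 2 ->
      `|k *: w + w' - C (k *: p + p')| < e.
    move=> h1 h2; rewrite linearP opprD addrACA -scalerBr.
    apply: (le_lt_trans (ler_normD _ _)); rewrite normrZ.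
    have : `|k| * `|w - C p| <= (`|k| + 1) * (e / (2 * (`|k| + 1))).
      by apply: ler_pM => //; [rewrite lerDl|exact: ltW].
    have -> : (`|k| + 1) * (e / (2 * (`|k| + 1))) = e / 2 by field; lra.
    lra.
  by exists (k *: p + p'); split; exact: aux.
have rel_norm x y : rel x y -> `|y| = `|x|.
  move=> h; apply/eqP; rewrite -subr_eq0 -normr_eq0 eq_le normr_ge0 andbT.
  apply/ler_addgt0Pr => e e0; rewrite add0r.
  have [p [xp yp]] := h _ (divr_gt0 e0 (@ltr0n R 2)).
  apply: (le_trans (ler_distD `|B p| _ _)).
  have h1 := le_trans (ler_dist_dist _ _) (ltW yp).
  have h2 := le_trans (ler_dist_dist _ _) (ltW xp).
  rewrite -{2}AB (distrC _ `|x|); lra.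
have rel_uniq x y y' : rel x y -> rel x y' -> y = y'.
  move=> h h'; apply/eqP; rewrite -subr_eq0 -normr_eq0.
  have := rel_norm _ _ (relP (-1) _ _ _ _ h h').
  by rewrite !scaleN1r addNr normr0 addrC distrC => ->.
have relA p : rel (A p) (B p) by move=> e e0; exists p; rewrite !subrr !normr0.
have rel_total x : exists y, rel x y.
  have [p hp] : {p : nat -> P & forall k, `|x - A (p k)| < 1 / 2 ^+ k}.
    apply: (@choice _ _ (fun k p => `|x - A p| < 1 / 2 ^+ k)) => k.
    by apply: dA; rewrite divr_gt0 ?exprn_gt0.
  have [y hy] : exists y, limit_in Num.norm (fun k => B (p k)) y.
    apply: banach_complete => e e0.
    have [N hN] := half_pow_lt (1 : R) (divr_gt0 e0 (@ltr0n R 2)).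
    exists N => n m Nn Nm; rewrite -linearB -AB linearB.
    apply: (le_lt_trans (ler_distD x _ _)); rewrite distrC.
    have := lt_trans (hp n) (hN _ Nn); have := lt_trans (hp m) (hN _ Nm).
    lra.
  exists y => e e0; have [N hN] := half_pow_lt (1 : R) e0; have [M hM] := hy _ e0.
  exists (p (maxn N M)); split; first exact: lt_trans (hp _) (hN _ (leq_maxl _ _)).
  by rewrite distrC; apply: hM; exact: leq_maxr.
have [h0 h0P] := choice rel_total.
have [h hE] : exists h : {linear X -> Y}, h =1 h0.
  apply: linear_exists => k x x'; apply: (rel_uniq (k *: x + x')) => //.
  exact: relP.
exists h; split=> [x|p]; rewrite hE; first exact: rel_norm.
exact: (rel_uniq (A p)).
Qed.

(** Polynomials serve as the vector space of finitely supported coefficients. *)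
Lemma poly_comb (X : lmodType R) (a : nat -> X) :
  exists A : {linear {poly R} -> X},
    (forall p, A p = comb (size p) (fun i => p`_i) a) /\
    forall n c, exists p, A p = comb n c a.
Proof.
pose A0 (p : {poly R}) := comb (size p) (fun i => p`_i) a.
have A0E M (p : {poly R}) : (size p <= M)%N -> A0 p = comb M (fun i => p`_i) a.
  move=> pM; rewrite /A0 -(comb_trunc _ _ pM); apply: eq_comb => i _.
  by rewrite /trunc; case: ltnP => // ?; rewrite nth_default.
have [A AE] : exists A : {linear {poly R} -> X}, A =1 A0.
  apply: linear_exists => k p p'.
  pose M := maxn (size (k *: p + p')) (maxn (size p) (size p')).
  rewrite !(A0E M) ?geq_max ?leq_max ?leqnn ?orbT //.
  rewrite -combZ -combD; apply: eq_comb => i _.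
  by rewrite coefD coefZ.
exists A; split=> [p|n c]; first exact: AE.
exists (\poly_(i < n) c i); rewrite AE (A0E n) ?size_poly //.
by apply: eq_comb => i iln; rewrite coef_poly iln.
Qed.

(** If both tuples are dense, exchanging them gives the inverse isometry. *)
Lemma isometry_of_tuples (X Y : completeNormedModType R)
    (TX : {linear X -> S}) (TY : {linear Y -> S}) (a : nat -> X) (b : nat -> Y) :
  nonexpansive TX -> nonexpansive TY ->
  (forall n c, `|comb n c a| = `|comb n c b|) ->
  (forall n c, TX (comb n c a) = TY (comb n c b)) ->
  (forall x e, 0 < e -> exists i, `|x - a i| < e) ->
  exists h : {linear X -> Y},
  [/\ isometric h, forall x, TY (h x) = TX x, forall i, h (a i) = b i
    & (forall y e, 0 < e -> exists i, `|y - b i| < e) -> bijective h].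
Proof.
move=> TX1 TY1 nab oab da.
have [A [AE Ac]] := poly_comb a; have [B [BE Bc]] := poly_comb b.
have ABn p : `|A p| = `|B p| by rewrite AE BE.
have Ai i : exists p, A p = a i /\ B p = b i.
  exists 'X^i; rewrite AE BE size_polyXn.
  have XE (W : lmodType R) (w : nat -> W) : comb i.+1 (fun j => ('X^i : {poly R})`_j) w = w i.
    by rewrite -(comb_unit w (ltnSn i)); apply: eq_comb => j _; rewrite coefXn.
  by rewrite !XE.
have [h [hiso hA]] : exists h : {linear X -> Y},
    (forall x, `|h x| = `|x|) /\ forall p, h (A p) = B p.
  apply: isometry_extension => // x e e0; have [i xi] := da x e e0.
  by have [p [pa _]] := Ai i; exists p; rewrite pa.
exists h; split=> [x _|x|i|db]; first exact: hiso.
- apply/eqP; rewrite -subr_eq0 -normr_eq0 eq_le normr_ge0 andbT.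
  apply/ler_addgt0Pr => e e0; rewrite add0r.
  have [i xi] := da x _ (divr_gt0 e0 (@ltr0n R 2)); have [p [pa _]] := Ai i.
  rewrite -pa in xi.
  have TAB : TY (h (A p)) = TX (A p) by rewrite hA AE BE -oab.
  apply: (le_trans (ler_distD (TX (A p)) _ _)).
  rewrite -{1}TAB -!linearB; have := TY1 (h (x - A p)); have := TX1 (A p - x).
  rewrite hiso (distrC _ x); lra.
- by have [p [<- <-]] := Ai i.
have [g [giso gB]] : exists g : {linear Y -> X},
    (forall x, `|g x| = `|x|) /\ forall p, g (B p) = A p.
  apply: isometry_extension => // x e e0; have [i xi] := db x e e0.
  by have [p [_ pb]] := Ai i; exists p; rewrite pb.
have inverse (V W : completeNormedModType R) (f : {linear V -> W}) (f' : {linear W -> V})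
    (C : {poly R} -> V) : (forall x, `|f x| = `|x|) -> (forall x, `|f' x| = `|x|) ->
    (forall p, f' (f (C p)) = C p) -> (forall x e, 0 < e -> exists p, `|x - C p| < e) ->
    cancel f f'.
  move=> fiso f'iso fC dC x; apply/eqP; rewrite -subr_eq0 -normr_eq0 eq_le normr_ge0 andbT.
  apply/ler_addgt0Pr => e e0; rewrite add0r.
  have [p xp] := dC x _ (divr_gt0 e0 (@ltr0n R 2)).
  apply: (le_trans (ler_distD (C p) _ _)).
  rewrite -{1}(fC p) -!linearB f'iso fiso (distrC _ x); lra.
exists g.
  apply: (inverse _ _ _ _ A) => // [p|x e e0]; first by rewrite hA gB.
  by have [i xi] := da x e e0; have [p [pa _]] := Ai i; exists p; rewrite pa.
apply: (inverse _ _ _ _ B) => // [p|x e e0]; first by rewrite gB hA.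
by have [i xi] := db x e e0; have [p [_ pb]] := Ai i; exists p; rewrite pb.
Qed.

(** Each vector must be approximated at arbitrarily late stages, where the errors of
a back-and-forth are small; every value of [logn 2] is attained infinitely often. *)
Lemma dense_sequence (E : completeNormedModType R) : separable E ->
  exists x : nat -> E, forall y e K, 0 < e -> exists2 k, (K <= k)%N & `|y - x k| < e.
Proof.
move=> [D [cD dD]].
have [f fD] : exists f : nat -> E, forall d, D d -> exists i, f i = d.
  have /countable_injP[g ginj] := cD.
  have [f fP] : {f : nat -> E & forall i, (exists2 d, D d & g d = i) -> D (f i) /\ g (f i) = i}.
    apply: (@choice _ _ (fun i x => (exists2 d, D d & g d = i) -> D x /\ g x = i)) => i.
    have [[d Dd gd]|no] := pselect (exists2 d, D d & g d = i); first by exists d.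
    by exists 0 => /no.
  exists f => d Dd; exists (g d); have [Df gf] := fP (g d) (ex_intro2 _ _ d Dd erefl).
  by apply: ginj; rewrite ?inE.
(* The index [2 ^ i * (2 * K).+1] is at least [K] and has 2-adic valuation [i]. *)
exists (fun k => f (logn 2 k)) => y e K e0.
have [d [Dd yd]] := dense_approx y dD e0; have [i fi] := fD _ Dd.
exists (2 ^ i * (2 * K).+1)%N.
  rewrite (@leq_trans (2 * K).+1) ?leq_pmull ?expn_gt0 //.
  by rewrite (leq_trans (leq_pmull K (ltn0Sn 1))) // leqnSn.
have odd0 : logn 2 (2 * K).+1 = 0%N by rewrite lognE dvdn2 /= mul2n odd_double.
by rewrite lognM ?expn_gt0 // pfactorK // odd0 addn0 fi.
Qed.

Lemma dependent_sequence (T : Type) (P : nat -> T -> Prop) (Q : nat -> T -> T -> Prop) s0 :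
  P 0%N s0 -> (forall k s, P k s -> exists s', P k.+1 s' /\ Q k s s') ->
  exists s : nat -> T, [/\ s 0%N = s0, forall k, P k (s k) & forall k, Q k (s k) (s k.+1)].
Proof.
move=> P0 step.
have [F FP] : {F : nat * T -> T & forall ks, P ks.1 ks.2 -> P ks.1.+1 (F ks) /\ Q ks.1 ks.2 (F ks)}.
  apply: (@choice _ _ (fun ks s' => P ks.1 ks.2 -> P ks.1.+1 s' /\ Q ks.1 ks.2 s')) => -[k s] /=.
  have [/step[s' h]|no] := pselect (P k s); first by exists s'.
  by exists s => /no.
pose s := fix s k := if k is k'.+1 then F (k', s k') else s0.
have Ps k : P k (s k) by elim: k => //= k IH; have [] := FP (k, s k) IH.
by exists s; split=> // k; have [] := FP (k, s k) (Ps k).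
Qed.

End LimitTuples.

(** * Back and forth *)

Section BackAndForth.
Context {R : realType} (S : completeNormedModType R).

Lemma comb_update (V : lmodType R) n m c (v : nat -> V) x : (n <= m)%N ->
  comb n c (update v m x) = comb n c v.
Proof.
move=> nm; apply: eq_comb => i iln; split=> //.
by rewrite /update ltn_eqF // (leq_trans iln).
Qed.

Lemma coordinate_le (E : normedModType R) n (v w : nat -> E) B :
  (forall c, `|comb n c v - comb n c w| <= B * l1 n c) ->
  forall i, (i < n)%N -> `|v i - w i| <= B.
Proof.
by move=> h i iln; have := h (fun j => (j == i)%:R); rewrite !comb_unit // l1_unit // mulr1.
Qed.

Lemma almost_eq_le (X Y : normedModType R) (T : X -> S) (T' : Y -> S) n q q' a b :
  (forall c, q c <= q' c) -> almost_eq T T' n q a b -> almost_eq T T' n q' a b.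
Proof. by move=> qq h c; have [h1 h2] := h c; split; exact: le_trans (qq c). Qed.

(** Two extensions: the first, applied to [U'], answers the prolongation of [a] by [x]
and moves only [b], by about [q]; the second, applied to [U], answers the
prolongation of [b] by [y] and moves only [a], by a negligible amount. *)
Lemma forth_and_back (G G' : completeNormedModType R)
    (U : {linear G -> S}) (U' : {linear G' -> S}) :
  nonexpansive U -> nonexpansive U' -> extendable U -> extendable U' ->
  forall n q a b, coef_gauge n q -> almost_eq U U' n q a b ->
  forall x y (delta : R), 0 < delta -> exists a' b',
  [/\ almost_eq U U' n.+2 (fun c => delta * l1 n.+2 c) a' b',
      forall c, `|comb n c a' - comb n c a| <= delta * l1 n c,
      forall c, `|comb n c b' - comb n c b| <= q c + delta * l1 n c,
      `|a' n - x| <= delta & b' n.+1 = y].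
Proof.
move=> U1 U1' ext ext' n q a b gq sim x y delta delta0.
pose eta := delta / 2; have eta0 : 0 < eta by rewrite divr_gt0.
have eta_le t : 0 <= t -> eta * t <= delta * t.
  by move=> t0; rewrite ler_wpM2r // /eta; lra.
pose a1 := update a n x.
have sim1 : almost_eq U' U n q b a1.
  by apply: almost_eq_sym => c; rewrite comb_update //; exact: sim.
have [b1 [sim2 close1]] := ext' _ _ U1 _ _ _ _ gq sim1 _ eta0.
pose b2 := update b1 n.+1 y.
have sim3 : almost_eq U U' n.+1 (fun c => eta * l1 n.+1 c) a1 b2.
  move=> c; have -> : comb n.+1 c b2 = comb n.+1 c b1 by exact: comb_update.
  exact: (almost_eq_sym sim2).
have [a2 [sim4 close2]] := ext _ _ U1' _ _ _ _ (gauge_l1 _ (ltW eta0)) sim3 _ eta0.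
have close3 c : `|comb n.+1 c a2 - comb n.+1 c a1| <= delta * l1 n.+1 c.
  apply: (le_trans (close2 c)); rewrite /eta; lra.
exists a2, b2; split.
- by apply: almost_eq_le sim4 => c; exact/eta_le/l1_ge0.
- move=> c; have := close3 (trunc n c).
  by rewrite !(comb_trunc _ _ (leqnSn n)) (l1_trunc _ (leqnSn n)) comb_update.
- move=> c; rewrite comb_update //; apply: (le_trans (close1 c)).
  by rewrite lerD2l; exact/eta_le/l1_ge0.
- by have := coordinate_le close3 (ltnSn n); rewrite /a1 /update eqxx.
- by rewrite /b2 /update eqxx.
Qed.

(** The error [q] is paid once, in the first step; the later steps cost a convergent
series that a small initial error makes smaller than [r]. *)
Lemma back_and_forth (G G' : completeNormedModType R)
    (U : {linear G -> S}) (U' : {linear G' -> S}) :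
  nonexpansive U -> nonexpansive U' -> extendable U -> extendable U' ->
  separable G -> separable G' ->
  forall n q a b, coef_gauge n q -> almost_eq U U' n q a b ->
  forall r : R, 0 < r -> exists h : {linear G -> G'},
  [/\ bijective h, isometric h, forall x, U' (h x) = U x
    & forall c, `|h (comb n c a) - comb n c b| <= q c + r * l1 n c].
Proof.
move=> U1 U1' ext ext' /dense_sequence[x xD] /dense_sequence[y yD].
move=> n q a b gq sim r r0.
(* The limits are within [4 * s] of the first tuples and these within [s] of
   [a] and [b]; both sides together give [10 * s]. *)
pose s := r / 10; have s0 : 0 < s by rewrite divr_gt0.
(* Stage [k] adds [x k] at index [N k] and [y k] at index [(N k).+1]. *)
pose N k := (n.+2 + k.*2)%N.
have NS k : N k.+1 = (N k).+2 by rewrite /N doubleS !addnS.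
have sk k : 0 < s / 2 ^+ k by rewrite divr_gt0 ?exprn_gt0.
have [a0 [b0 [sim0 closea closeb _ _]]] :=
  forth_and_back U1 U1' ext ext' gq sim 0 0 s0.
pose P k (ab : (nat -> G) * (nat -> G')) :=
  almost_eq U U' (N k) (fun c => s / 2 ^+ k * l1 (N k) c) ab.1 ab.2.
pose Q k (ab ab' : (nat -> G) * (nat -> G')) :=
  [/\ forall i, (i < N k)%N -> `|ab'.1 i - ab.1 i| <= 2 * s / 2 ^+ k,
      forall i, (i < N k)%N -> `|ab'.2 i - ab.2 i| <= 2 * s / 2 ^+ k,
      `|ab'.1 (N k) - x k| <= s / 2 ^+ k & ab'.2 (N k).+1 = y k].
have P0 : P 0%N (a0, b0) by rewrite /P /N addn0 expr0 divr1.
have step k ab : P k ab -> exists ab', P k.+1 ab' /\ Q k ab ab'.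
  move=> Pk; have half : s / 2 ^+ k.+1 <= s / 2 ^+ k.
    by rewrite ler_wpM2l ?(ltW s0) // lef_pV2 ?posrE ?exprn_gt0 // ler_eXn2l ?ltr1n.
  have [a' [b' [sim' ca cb ax bY]]] := forth_and_back U1 U1' ext ext'
    (gauge_l1 _ (ltW (sk k))) Pk (x k) (y k) (sk k.+1).
  exists (a', b'); split; first by rewrite /P NS.
  have dbl : 2 * s / 2 ^+ k = s / 2 ^+ k + s / 2 ^+ k by ring.
  have sk' := sk k.
  split=> //=; last exact: le_trans ax half.
    move=> i iN; apply: (le_trans (coordinate_le ca iN)); lra.
  move=> i iN; apply: (@coordinate_le _ _ _ _ (2 * s / 2 ^+ k)) iN => c.
  apply: (le_trans (cb c)); rewrite -mulrDl ler_wpM2r ?l1_ge0 //; lra.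
have [ab [ab0 Pab Qab]] := dependent_sequence P0 step.
have s20 : 0 <= 2 * s by lra.
have Nmono : {homo N : i j / (i <= j)%N} by move=> i j ij; rewrite leq_add2l leq_double.
have Nk k : (k <= N k)%N by rewrite /N -addnn addnA leq_addl.
have [a' [b' [aa' bb' nab oab]]] : exists (a' : nat -> G) (b' : nat -> G'),
  [/\ forall k i, (i < N k)%N -> `|a' i - (ab k).1 i| <= 2 * (2 * s) / 2 ^+ k,
      forall k i, (i < N k)%N -> `|b' i - (ab k).2 i| <= 2 * (2 * s) / 2 ^+ k,
      forall n c, `|comb n c a'| = `|comb n c b'|
    & forall n c, U (comb n c a') = U' (comb n c b')].
  apply: limit_tuples => // k; [|by case: (Qab k)..].
  apply: almost_eq_le (Pab k) => c; rewrite ler_wpM2r ?l1_ge0 //.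
  by rewrite ler_wpM2r ?invr_ge0 ?exprn_ge0 //; lra.
have small e : 0 < e -> exists K, forall k, (K <= k)%N -> 3 * (s / 2 ^+ k) < e / 2.
  move=> e0; have [K hK] := half_pow_lt (3 * s) (divr_gt0 e0 (@ltr0n R 2)).
  by exists K => k /hK; rewrite mulrA.
have halve k : 2 * (2 * s) / 2 ^+ k.+1 = 2 * (s / 2 ^+ k).
  by rewrite exprS; field; exact: expf_neq0.
have [|h [hiso hop hab hbij]] := @isometry_of_tuples R S G G' U U' a' b' U1 U1' nab oab.
  move=> z e e0; have [K hK] := small e e0.
  have [k Kk zk] := xD z _ K (divr_gt0 e0 (@ltr0n R 2)); exists (N k).
  have iN : (N k < N k.+1)%N by rewrite NS ltnW.
  have [_ _ h3 _] := Qab k; have := aa' _ _ iN; rewrite halve => h4.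
  have h5 := hK _ Kk.
  apply: (le_lt_trans (ler_distD (x k) _ _)).
  have := ler_distD ((ab k.+1).1 (N k)) (x k) (a' (N k)).
  rewrite (distrC (x k) ((ab k.+1).1 (N k))) (distrC ((ab k.+1).1 (N k)) (a' (N k))); lra.
exists h; split=> //.
  apply: hbij => z e e0; have [K hK] := small e e0.
  have [k Kk zk] := yD z _ K (divr_gt0 e0 (@ltr0n R 2)); exists (N k).+1.
  have iN : ((N k).+1 < N k.+1)%N by rewrite NS.
  have [_ _ _ h3] := Qab k; have := bb' _ _ iN; rewrite halve h3 => h4.
  have h5 := hK _ Kk; have sk' := sk k.
  apply: (le_lt_trans (ler_distD (y k) _ _)); rewrite (distrC (y k)); lra.
move=> c; have hc : h (comb n c a') = comb n c b'.
  by rewrite linear_comb; apply: eq_comb => i _; rewrite /= hab.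
have nN i : (i < n)%N -> (i < N 0)%N by move=> iln; rewrite /N addn0 ltnW // ltnW.
have ha : `|comb n c a' - comb n c a0| <= 4 * s * l1 n c.
  rewrite combBr; apply: norm_comb_le => i /nN /aa'.
  by rewrite ab0 expr0 divr1 /= => h1; apply: (le_trans h1); lra.
have hb : `|comb n c b' - comb n c b0| <= 4 * s * l1 n c.
  rewrite combBr; apply: norm_comb_le => i /nN /bb'.
  by rewrite ab0 expr0 divr1 /= => h1; apply: (le_trans h1); lra.
have ha0 := closea c; have hb0 := closeb c.
apply: (le_trans (ler_distD (comb n c b') _ _)).
rewrite -hc -linearB hiso // hc.
have := ler_distD (comb n c a0) (comb n c a) (comb n c a').
rewrite (distrC (comb n c a0) (comb n c a')) (distrC (comb n c a) (comb n c a0)) => h1.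
have := ler_distD (comb n c b0) (comb n c b') (comb n c b) => h2.
have : r * l1 n c = 10 * s * l1 n c by rewrite /s; congr (_ * _); field.
lra.
Qed.

(** The forth half alone: the dense sequence of [X] never moves. *)
Lemma extendable_universal (G : completeNormedModType R) (U : {linear G -> S}) :
  nonexpansive U -> extendable U -> universal_operator U.
Proof.
move=> U1 ext X /dense_sequence[x xD] T /opnorm_le1 T1.
pose P k (b : nat -> G) := almost_eq T U k (fun c => 1 / 2 ^+ k * l1 k c) x b.
pose Q k (b b' : nat -> G) := forall i, (i < k)%N -> `|b' i - b i| <= 2 / 2 ^+ k.
have pow_gt0 k : 0 < 1 / 2 ^+ k :> R by rewrite divr_gt0 ?exprn_gt0.
have P0 : P 0%N (fun=> 0).
  move=> c; rewrite !comb0 !linear0 !normr0 !subrr !normr0.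
  by rewrite addr0 normr0; split; rewrite mulr_ge0 ?l1_ge0 // ltW.
have step k b : P k b -> exists b', P k.+1 b' /\ Q k b b'.
  move=> Pk; have [b' [sim close]] := ext _ _ T1 _ _ _ _
    (gauge_l1 k (ltW (pow_gt0 k))) (almost_eq_sym Pk) _ (pow_gt0 k.+1).
  exists b'; split; first exact: almost_eq_sym.
  apply: coordinate_le => c; apply: (le_trans (close c)); rewrite -mulrDl ler_wpM2r ?l1_ge0 //.
  have -> : 1 / 2 ^+ k.+1 = 1 / 2 ^+ k / 2 :> R by rewrite exprS; field; exact: expf_neq0.
  have := pow_gt0 k; lra.
have [b [_ Pb Qb]] := dependent_sequence P0 step.
have sim2 k : almost_eq T U k (fun c => 2 / 2 ^+ k * l1 k c) x (b k).
  apply: almost_eq_le (Pb k) => c; rewrite ler_wpM2r ?l1_ge0 //.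
  by rewrite ler_wpM2r ?invr_ge0 ?exprn_ge0 // ler1n.
have const k i : (i < k)%N -> `|x i - x i| <= 2 / 2 ^+ k.
  by move=> _; rewrite subrr normr0 divr_ge0 ?exprn_ge0.
have [a' [b' [aa' bb' nab oab]]] := @limit_tuples R S X G T U id 2 (fun=> x) b T1 U1
  (fun _ _ ij => ij) leqnn (ler0n R 2) sim2 const Qb.
have xa i : a' i = x i.
  apply/eqP; rewrite -subr_eq0 -normr_eq0; apply/eqP; apply: (@eq0_of_half_pow _ _ (2 * 2)) => // k.
  by exists (maxn k i.+1); [exact: leq_maxl|apply: aa'; exact: leq_maxr].
have [|h [hiso hop _ _]] := @isometry_of_tuples R S X G T U a' b' T1 U1 nab oab.
  by move=> z e e0; have [k _ zk] := xD z e 0%N e0; exists k; rewrite xa.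
by exists h.
Qed.

End BackAndForth.

(** * Separability *)

Section Separability.
Context {R : realType}.
Implicit Types E F : completeNormedModType R.

(** [D] may leave [A]; this makes the notion stable under images and sums without
any choice of points of [A]. *)
Definition approximable E (A : set E) : Prop := exists D : set E,
  countable D /\ forall x, A x -> forall e : R, 0 < e -> exists2 d, D d & `|x - d| < e.

Lemma separableP E : separable E <-> approximable [set: E].
Proof.
split=> -[D [cD dD]]; exists D; split=> //.
  by move=> x _ e e0; have [d [Dd xd]] := dense_approx x dD e0; exists d.
move=> O [x Ox] oO; have /nbhs_ballP[e /= e0 he] : nbhs x O by exact: open_nbhs_nbhs.
by have [d Dd xd] := dD x I e e0; exists d; split=> //; apply: he; rewrite -ball_normE.
Qed.

Lemma approximable_image E F (f : {linear E -> F}) (K : R) (A : set E) :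
  (forall x, `|f x| <= K * `|x|) -> approximable A -> approximable (f @` A).
Proof.
move=> fK [D [cD dD]]; exists (f @` D); split.
  exact: sub_countable (card_image_le _ _) cD.
move=> _ [x Ax <-] e e0.
have K0 : 0 < `|K| + 1 by rewrite ltr_wpDl.
have [d Dd xd] := dD x Ax _ (divr_gt0 e0 K0); exists (f d); first by exists d.
rewrite -linearB; apply: (le_lt_trans (fK _)).
move: xd; rewrite ltr_pdivlMr // mulrC => xd; apply: le_lt_trans xd.
by rewrite ler_wpM2r // (le_trans (ler_norm _)) // lerDl.
Qed.

(** Rational coefficients suffice. *)
Lemma approximable_add E (A : set E) v : approximable A ->
  approximable [set z | exists x t, A x /\ z = x + t *: v].
Proof.
move=> [D [cD dD]].
exists ((fun p : E * rat => p.1 + ratr p.2 *: v) @` (D `*` setT)); split.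
  by apply: sub_countable (card_image_le _ _) _; exact: countableX.
move=> _ [x [t [Ax ->]]] e e0.
have [d Dd xd] := dD x Ax _ (divr_gt0 e0 (@ltr0n R 2)).
have v0 : 0 < 2 * (`|v| + 1) by rewrite mulr_gt0 // ltr_wpDl.
have ev : 0 < e / (2 * (`|v| + 1)) by rewrite divr_gt0.
have [s] : exists s : rat, ratr s \in `]t - e / (2 * (`|v| + 1)), t[.
  by apply: rat_in_itvoo; lra.
rewrite in_itv /= => /andP[s1 s2]; exists (d + ratr s *: v); first by exists (d, s).
rewrite opprD addrACA -scalerBl; apply: (le_lt_trans (ler_normD _ _)).
rewrite normrZ ger0_norm; last lra.
have : (t - ratr s) * `|v| <= e / (2 * (`|v| + 1)) * (`|v| + 1).
  by apply: ler_pM => //; rewrite ?lerDl //; lra.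
have -> : e / (2 * (`|v| + 1)) * (`|v| + 1) = e / 2.
  by field; rewrite gt_eqF // ltr_wpDl.
lra.
Qed.

Lemma approximable_span E (A : set E) m (v : nat -> E) : approximable A ->
  approximable [set z | exists x c, A x /\ z = x + comb m c v].
Proof.
move=> hA; elim: m => [|m IH].
  move: hA => [D [cD dD]]; exists D; split=> // _ [x [c [Ax ->]]].
  by rewrite comb0 addr0; exact: dD.
have [D [cD dD]] := approximable_add (v m) IH; exists D; split=> // _ [x [c [Ax ->]]].
by rewrite combS addrA; apply: dD; exists (x + comb m c v), (c m); split=> //; exists x, c.
Qed.

Lemma approximable0 E : approximable [set (0 : E)].
Proof.
exists [set 0]; split; first exact: countable1.
by move=> x -> e e0; exists 0 => //; rewrite subrr normr0.
Qed.

Lemma fin_dim_approximable E (A : set E) : fin_dim_subspace A -> approximable A.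
Proof.
move=> /fin_dim_subspaceP[n [b hb]].
have [D [cD dD]] := approximable_span n b (approximable0 E); exists D; split=> //.
by move=> x /hb[c ->]; apply: dD; exists 0, c; rewrite add0r.
Qed.

Lemma finite_dimensional_separable E : finite_dimensional E -> separable E.
Proof. by move=> h; exact/separableP/fin_dim_approximable. Qed.

Lemma separable_span E F (f : {linear E -> F}) m (v : nat -> F) : isometric f ->
  separable E -> (forall z, exists x c, z = f x + comb m c v) -> separable F.
Proof.
move=> fiso /separableP sE h; apply/separableP.
have [|D [cD dD]] := approximable_span m v (@approximable_image _ _ f 1 _ _ sE).
  by move=> x; rewrite mul1r fiso.
exists D; split=> // z _; have [x [c ->]] := h z.
by apply: dD; exists (f x), c; split=> //; exists x.
Qed.

Lemma approximable_bigcup E (A : nat -> set E) :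
  (forall n, approximable (A n)) -> approximable (\bigcup_n A n).
Proof.
move=> /choice[D hD]; exists (\bigcup_n D n); split.
  by apply: bigcup_countable => // n _; case: (hD n).
move=> x [n _ Anx] e e0; have [_ h] := hD n; have [d Dd xd] := h x Anx e e0.
by exists d => //; exists n.
Qed.

Lemma dense_approximable E (A : set E) : dense A -> approximable A -> separable E.
Proof.
move=> dA [D [cD dD]]; apply/separableP; exists D; split=> // x _ e e0.
have e20 : 0 < e / 2 by rewrite divr_gt0.
have [y [Ay xy]] := dense_approx x dA e20; have [d Dd yd] := dD y Ay _ e20.
exists d => //; apply: (le_lt_trans (ler_distD y _ _)); lra.
Qed.

End Separability.

(** * Bases of finite-dimensional subspaces *)

Section Bases.
Context {R : realType}.
Implicit Types E F : completeNormedModType R.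

Definition independent E n (b : nat -> E) : Prop :=
  forall c, comb n c b = 0 -> l1 n c = 0.

Lemma l1_eq0 n (c : nat -> R) : l1 n c = 0 -> forall i, (i < n)%N -> c i = 0.
Proof.
move=> h i iln; apply/eqP; rewrite -normr_eq0 eq_le normr_ge0 andbT -h.
exact: l1_coef.
Qed.

(** Vectors of [b] that are already in the span are dropped, the others are appended. *)
Lemma extend_basis E n (a : nat -> E) m (b : nat -> E) : independent n a ->
  exists N a', [/\ (n <= N)%N, independent N a', forall i, (i < n)%N -> a' i = a i
    & forall x, (exists c, x = comb N c a') <-> (exists c d, x = comb n c a + comb m d b)].
Proof.
move=> ind; elim: m => [|m [N [a' [nN ind' aa' span]]]].
  exists n, a; split=> // x; split=> [[c ->]|[c [d ->]]].
    by exists c, (fun=> 0); rewrite comb0 addr0.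
  by exists c; rewrite comb0 addr0.
have [[c0 hc0]|no] := pselect (exists c, b m = comb N c a').
  exists N, a'; split=> // x; split.
    move=> /span[c [d ->]]; exists c, (update d m 0); rewrite combS /update eqxx scale0r addr0.
    by congr (_ + _); apply: eq_comb => i im; rewrite ltn_eqF.
  move=> [c [d ->]]; have /span[c' hc'] : exists c' d',
      comb n c a + comb m d b = comb n c' a + comb m d' b by exists c, d.
  exists (fun i => d m * c0 i + c' i).
  by rewrite combS combD combZ addrA hc' hc0 addrC.
exists N.+1, (update a' N (b m)).
have upE c : comb N.+1 c (update a' N (b m)) = comb N c a' + c N *: b m.
  rewrite combS /update eqxx; congr (_ + _).
  by apply: eq_comb => i iN; rewrite ltn_eqF.
split=> [||i iln|x].
- exact: leqW.
- move=> c; rewrite upE => h0.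
  (* A nonzero coefficient of [b m] would put it in the span of [a']. *)
  have cN : c N = 0.
    apply: contrapT => /eqP cN; apply: no; exists (fun i => - (c N)^-1 * c i).
    have -> : comb N (fun i => - (c N)^-1 * c i) a' = - ((c N)^-1 *: comb N c a').
      by rewrite combZ scaleNr.
    move/eqP: h0; rewrite addr_eq0 => /eqP ->.
    by rewrite scalerN opprK scalerA mulVf // scale1r.
  by rewrite l1S cN normr0 addr0; apply: ind'; move: h0; rewrite cN scale0r addr0.
- by rewrite /update ltn_eqF ?aa' // (leq_trans iln).
- split=> [[c ->]|[c [d ->]]].
    rewrite upE; have /span[c' [d' ->]] : exists c', comb N c a' = comb N c' a' by exists c.
    exists c', (update d' m (c N)); rewrite combS /update eqxx addrA; congr (_ + _ + _).
    by apply: eq_comb => i im; rewrite ltn_eqF.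
  have /span[c' hc'] : exists c' d',
      comb n c a + comb m d b = comb n c' a + comb m d' b by exists c, d.
  exists (update c' N (d m)); rewrite upE combS addrA hc' /update eqxx; congr (_ + _).
  by apply: eq_comb => i iN; rewrite ltn_eqF.
Qed.

Lemma fin_dim_basis E (A : set E) : fin_dim_subspace A ->
  exists n b, independent n b /\ forall x, A x <-> exists c, x = comb n c b.
Proof.
move=> /fin_dim_subspaceP[m [b hb]].
have ind0 : independent 0 b by move=> c _; rewrite /l1 big_ord0.
have [N [a' [_ ind' _ span]]] := extend_basis m b ind0.
exists N, a'; split=> // x; rewrite hb span; split=> [[c ->]|[c [d ->]]].
  by exists c, c; rewrite comb0 add0r.
by exists d; rewrite comb0 add0r.
Qed.

(** [F] is continuous and positive on the compact sphere of [l1]; its minimum there is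
the constant, by homogeneity. *)
Lemma homogeneous_lower_bound n (F : (nat -> R) -> R) (K : R) :
  (forall c d, `|F c - F d| <= K * l1 n (fun i => c i - d i)) ->
  (forall k c, F (fun i => k * c i) = `|k| * F c) ->
  (forall c, l1 n c != 0 -> 0 < F c) ->
  exists2 eta : R, 0 < eta & forall c, eta * l1 n c <= F c.
Proof.
move=> Flip Fhom Fpos.
have Floc c d : (forall i, (i < n)%N -> c i = d i) -> F c = F d.
  move=> cd; apply/eqP; rewrite -subr_eq0 -normr_eq0 eq_le normr_ge0 andbT.
  apply: (le_trans (Flip _ _)); rewrite /l1 big1 ?mulr0 // => i _.
  by rewrite cd ?ltn_ord // subrr normr0.
case: n => [|n] in Flip Fpos Floc *.
  exists 1 => // c; rewrite /l1 big_ord0 mulr0.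
  have -> : F c = F (fun i => 0 * c i) by exact: Floc.
  by rewrite Fhom normr0 mul0r.
have lip_continuous (f : 'rV[R]_n.+1 -> R) L :
    (forall v w, `|f v - f w| <= L * `|v - w|) -> continuous f.
  move=> fL v; have FF := nbhs_filter v.
  apply/(@cvgrPdist_lt R R _ (nbhs v) FF) => e e0.
  have L0 : 0 < `|L| + 1 by rewrite ltr_wpDl.
  apply/nbhs_ballP; exists (e / (`|L| + 1)); first by rewrite /= divr_gt0.
  move=> w; rewrite -ball_normE /= ltr_pdivlMr // => vw.
  apply: (le_lt_trans (fL _ _)); apply: le_lt_trans vw; rewrite mulrC.
  by rewrite ler_wpM2l // (le_trans (ler_norm _)) // lerDl.
have K0 : 0 <= K.
  have := le_trans (normr_ge0 _) (Flip (fun=> 1) (fun=> 0)).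
  by rewrite pmulr_lge0 // /l1 big_ord_recl subr0 normr1 ltr_wpDr // sumr_ge0.
have coefsB (v w : 'rV[R]_n.+1) : l1 n.+1 (fun i => coefs v i - coefs w i) = l1 n.+1 (coefs (v - w)).
  apply: eq_l1 => i _; rewrite -(scaleN1r w) coefsD coefsZ; ring.
pose f (v : 'rV[R]_n.+1) := F (coefs v).
pose g (v : 'rV[R]_n.+1) := l1 n.+1 (coefs v).
have fc : continuous f.
  apply: (@lip_continuous _ (K * n.+1%:R)) => v w; apply: (le_trans (Flip _ _)).
  by rewrite coefsB -mulrA ler_wpM2l // l1_le_row_norm.
have gc : continuous g.
  apply: (@lip_continuous _ n.+1%:R) => v w; rewrite /g.
  apply: le_trans (l1_le_row_norm _); rewrite -coefsB ler_norml.
  have h1 := l1D n.+1 (fun i => coefs v i - coefs w i) (coefs w).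
  have h2 := l1D n.+1 (fun i => coefs w i - coefs v i) (coefs v).
  have e1 : l1 n.+1 (fun i => coefs v i - coefs w i + coefs w i) = l1 n.+1 (coefs v).
    by apply: eq_l1 => i _; rewrite subrK.
  have e2 : l1 n.+1 (fun i => coefs w i - coefs v i + coefs v i) = l1 n.+1 (coefs w).
    by apply: eq_l1 => i _; rewrite subrK.
  have e3 : l1 n.+1 (fun i => coefs w i - coefs v i) = l1 n.+1 (fun i => coefs v i - coefs w i).
    by apply: eq_bigr => i _; rewrite distrC.
  by apply/andP; split; lra.
pose sphere := [set v | g v = 1].
have sphere0 : sphere !=set0.
  exists (row_of n.+1 (fun i => (i == 0)%:R)).
  by rewrite /sphere /= /g l1_coefs_row_of l1_unit.
have csphere : compact sphere.
  apply: bounded_closed_compact.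
    exists 1; split; first exact: num_real.
    move=> M M1 v /= gv; apply: (le_trans (row_norm_le_l1 v)).
    by rewrite -/(g v) gv ltW.
  have -> : sphere = g @^-1` [set 1] by [].
  by apply: closed_comp => //; exact: closed1.
have [v vS vmin] := EVT_min_rV sphere0 csphere (continuous_subspaceT fc).
have fv0 : 0 < f v.
  by apply: Fpos; rewrite -/(g v); have /set_mem -> := vS; exact: oner_neq0.
exists (f v) => // c; have [->|c0] := eqVneq (l1 n.+1 c) 0.
  have [hc|c0] := pselect (l1 n.+1 c = 0); last by rewrite mulr0 ltW // Fpos //; exact/eqP.
  have -> : F c = F (fun i => 0 * c i).
    by apply: Floc => i iln; rewrite mul0r (l1_eq0 hc).
  by rewrite Fhom normr0 mul0r mulr0.
have lpos : 0 < l1 n.+1 c by rewrite lt_neqAle eq_sym c0 l1_ge0.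
pose d i := (l1 n.+1 c)^-1 * c i.
have dS : row_of n.+1 d \in sphere.
  apply/mem_set; rewrite /sphere /= /g l1_coefs_row_of l1Z ger0_norm ?invr_ge0 ?l1_ge0 //.
  by rewrite mulVf.
have := vmin _ dS; rewrite {2}/f.
have -> : F (coefs (row_of n.+1 d)) = F d.
  by apply: Floc => i iln; rewrite coefs_row_of /trunc iln.
by rewrite Fhom ger0_norm ?invr_ge0 ?l1_ge0 // mulrC ler_pdivlMr.
Qed.

Lemma basis_bound E n (b : nat -> E) : independent n b ->
  exists2 C : R, 0 < C & forall c, l1 n c <= C * `|comb n c b|.
Proof.
move=> ind; have [M M0 bM] := tuple_bounded n b.
have [|||eta eta0 h] := @homogeneous_lower_bound n (fun c => `|comb n c b|) M.
- by move=> c d; apply: (le_trans (ler_dist_dist _ _)); rewrite -combB; exact: norm_comb_le.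
- by move=> k c; rewrite combZ normrZ.
- move=> c c0; rewrite normr_gt0; apply: contra_neq c0; exact: ind.
exists eta^-1; first by rewrite invr_gt0.
by move=> c; rewrite mulrC ler_pdivlMr // mulrC.
Qed.

End Bases.

(** * Almost homogeneity *)

Section AlmostHomogeneous.
Context {R : realType} (S : completeNormedModType R).

Lemma linear_on_comb (E F : completeNormedModType R) (A : set E) (f : E -> F) n b :
  linear_on A f -> (forall x, A x <-> exists c, x = comb n c b) ->
  forall c, f (comb n c b) = comb n c (f \o b).
Proof.
move=> lf hA c.
have A0 : A 0 by apply/hA; exists (fun=> 0); rewrite comb_const0.
have f0 : f 0 = 0.
  have := lf 1 0 0 A0 A0; rewrite !scale1r addr0 => h.
  by apply: (@addrI _ (f 0)); rewrite addr0 -h.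
suff h k : (k <= n)%N -> f (comb k c b) = comb k c (f \o b) by exact: h.
elim: k => [|k IH] kn; first by rewrite !comb0.
rewrite !combS addrC lf ?IH 1?addrC //; first exact: ltnW.
  by apply/hA; exists (fun i => (i == k)%:R); rewrite comb_unit.
by apply/hA; exists (trunc k c); rewrite comb_trunc // ltnW.
Qed.

(** The strict inequalities hold vector by vector; compactness makes them uniform,
applied to the function [F0], which is positive off zero since
[1 - e <= (1 + e)^-1]. *)
Lemma eps_isometric_gap (E F : completeNormedModType R) (A : set E) (f : E -> F)
    n b (e : R) :
  0 < e -> linear_on A f -> (forall x, A x <-> exists c, x = comb n c b) ->
  independent n b -> eps_isometric_on e A f ->
  exists2 e', e' < e &
    forall c, `| `|comb n c b| - `|comb n c (f \o b)| | <= e' * `|comb n c b|.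
Proof.
move=> e0 lf hA ind fe; have fcomb := linear_on_comb lf hA.
have [M M0 bM] := tuple_bounded n b; have [M' M'0 fbM] := tuple_bounded n (f \o b).
pose D c := `| `|comb n c b| - `|comb n c (f \o b)| |.
pose F0 c := e * `|comb n c b| - D c.
have [|||eta eta0 heta] := @homogeneous_lower_bound R n F0 (e * M + (M + M')).
- move=> c d.
  have hb : `|comb n c b - comb n d b| <= M * l1 n (fun i => c i - d i).
    by rewrite -combB; exact: norm_comb_le.
  have hf : `|comb n c (f \o b) - comb n d (f \o b)| <= M' * l1 n (fun i => c i - d i).
    by rewrite -combB; exact: norm_comb_le.
  have h1 := le_trans (ler_dist_dist _ _) hb; have h2 := le_trans (ler_dist_dist _ _) hf.
  have hD : `|D c - D d| <= (M + M') * l1 n (fun i => c i - d i).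
    apply: (le_trans (ler_dist_dist _ _)); rewrite opprD addrACA -opprD.
    rewrite mulrDl; apply: (le_trans (ler_normB _ _)); exact: lerD.
  have -> : F0 c - F0 d = e * (`|comb n c b| - `|comb n d b|) - (D c - D d).
    by rewrite /F0; ring.
  rewrite [(e * M + _) * _]mulrDl; apply: (le_trans (ler_normB _ _)).
  by apply: lerD => //; rewrite normrM gtr0_norm // -mulrA ler_wpM2l // ltW.
- move=> k c; rewrite /F0 /D !combZ !normrZ -mulrBr normrM normr_id mulrBr.
  by rewrite mulrCA.
- move=> c c0; rewrite subr_gt0 /D -fcomb.
  have x0 : comb n c b != 0 by apply: contra_neq c0; exact: ind.
  have nx : 0 < `|comb n c b| by rewrite normr_gt0.
  have [lo hi] := fe (comb n c b) ((hA _).2 (ex_intro _ c erefl)) x0.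
  rewrite ltr_norml; apply/andP; split; first lra.
  have : (1 - e) * `|comb n c b| <= (1 + e)^-1 * `|comb n c b|.
    rewrite ler_pM2r // -[leRHS]mul1r ler_pdivlMr; last lra.
    by have := sqr_ge0 e; rewrite expr2; lra.
  lra.
exists (e - eta / (M + 1)); first by rewrite gtrBl divr_gt0 // ltr_wpDl.
move=> c; have := heta c; rewrite /F0 -/(D c).
have h1 : `|comb n c b| <= (M + 1) * l1 n c.
  by apply: (le_trans (norm_comb_le c bM)); rewrite ler_wpM2r ?l1_ge0 // lerDl.
have M1 : 0 < M + 1 by rewrite ltr_wpDl.
have : eta / (M + 1) * `|comb n c b| <= eta * l1 n c.
  rewrite -mulrA ler_wpM2l ?(ltW eta0) // mulrC ler_pdivrMr //.
  by rewrite mulrC.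
lra.
Qed.

(** An [e]-isometric embedding [f] of the span of [b] makes [b] and [f \o b] almost
equal with an error [e3 * `|comb n c b|], [e3 < e]; the error [r * l1 n c] added by
the back-and-forth is absorbed in [e - e3] because [b] is a basis. *)
Lemma extendable_almost_homogeneous (G : completeNormedModType R) (U : {linear G -> S}) :
  nonexpansive U -> separable G -> extendable U -> almost_homogeneous_operator U.
Proof.
move=> U1 sG ext e e0 E E' /fin_dim_basis[n [b [ind hE]]] _ f lf _ fe fU.
have fcomb := linear_on_comb lf hE.
have [e1 e1e he1] := eps_isometric_gap e0 lf hE ind fe.
have EC c : E (comb n c b) by apply/hE; exists c.
have [|k x Ex|e2 [e20 e2e he2]] := opnorm_on_lt _ _ fU.
- by apply/hE; exists (fun=> 0); rewrite comb_const0.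
- have [c xc] := (hE x).1 Ex; split.
    by apply/hE; exists (fun i => k * c i); rewrite combZ xc.
  rewrite xc -combZ !fcomb !combZ scalerBr !linearZ //.
have [C C0 hC] := basis_bound ind.
pose e3 := Num.max e1 e2; have e3e : e3 < e by rewrite gt_max e1e.
have e30 : 0 <= e3 by rewrite le_max e20 orbT.
pose q c := e3 * `|comb n c b|.
have gq : coef_gauge n q.
  split=> [c d|k c|c d cd].
  - by rewrite /q combD -mulrDr ler_wpM2l // ler_normD.
  - by rewrite /q combZ normrZ mulrCA.
  - by rewrite /q (@eq_comb _ _ n c d b b) // => i iln; rewrite cd.
have sim : almost_eq U U n q b (f \o b).
  move=> c; split.
    by apply: (le_trans (he1 c)); rewrite /q ler_wpM2r // le_max lexx.
  rewrite -fcomb distrC; apply: (le_trans (he2 _ (EC c))).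
  by rewrite /q ler_wpM2r // le_max lexx orbT.
pose r := (e - e3) / (2 * C).
have r0 : 0 < r by rewrite divr_gt0 ?subr_gt0 // mulr_gt0.
have [h [hbij hiso hop hclose]] := back_and_forth U1 U1 ext ext sG sG gq sim r0.
exists h; split=> //; apply: (@lt_opnorm_on _ _ _ _ _ (e3 + (e - e3) / 2)).
- by rewrite addr_ge0 // divr_ge0 // subr_ge0 ltW.
- lra.
move=> x /hE[c ->]; rewrite fcomb; apply: (le_trans (hclose c)).
rewrite mulrDl lerD2l.
have -> : (e - e3) / 2 * `|comb n c b| = r * (C * `|comb n c b|) by rewrite /r; field; lra.
by rewrite ler_wpM2l // ltW.
Qed.

(** Here the amalgam is taken over the whole of [G].  By universality it embeds in [G]
with its operator, through [j]; the inverse of [j \o i] on the span of [a] is an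
isometry that preserves [U], so almost homogeneity supplies an isometry [h] with
[h \o j \o i] close to the identity there. *)
Lemma universal_homogeneous_extendable (G : completeNormedModType R) (U : {linear G -> S}) :
  nonexpansive U -> separable G -> universal_operator U ->
  almost_homogeneous_operator U -> extendable U.
Proof.
move=> U1 sG univ homog Y T T1 n q a b gq sim delta delta0.
have [M M0 aM] := tuple_bounded n a.
pose eta := delta / 4; have eta0 : 0 < eta by rewrite divr_gt0.
have [Z [TZ [i [v [TZ1 iiso iop spanZ [vnorm vop vclose]]]]]] :=
  amalgam_exists U1 T1 (leqnSn n) gq sim eta0.
have sZ : separable Z by apply: separable_span sG spanZ => x _; exact: iiso.
have [j [jiso jop]] := univ Z sZ TZ ((opnorm_le1 TZ).2 TZ1).
have jiiso w : `|j (i w)| = `|w| by rewrite jiso // iiso.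
pose E := [set z | exists c, z = j (i (comb n c a))].
pose E' := [set z | exists c, z = comb n c a].
have hE : fin_dim_subspace E.
  apply/fin_dim_subspaceP; exists n, (fun k => j (i (a k))) => x.
  by split=> -[c ->]; exists c; rewrite !linear_comb.
have hE' : fin_dim_subspace E' by apply/fin_dim_subspaceP; exists n, a.
(* The inverse of [j \o i] on its range; 0 is a default value outside. *)
pose f z := xget 0 [set w | j (i w) = z].
have fK w : f (j (i w)) = w.
  rewrite /f; case: xgetP => [w' _ /= h|/(_ w)]; last by move=> /(_ erefl).
  by apply/eqP; rewrite -subr_eq0 -normr_eq0 -jiiso !linearB /= h subrr normr0.
have lf : linear_on E f.
  by move=> k _ _ [c ->] [d ->]; rewrite !fK -!linearP fK.
have fE : forall x, E x -> E' (f x) by move=> _ [c ->]; rewrite fK; exists c.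
pose e := delta / (2 * (M + 1)); have M1 : 0 < M + 1 by rewrite ltr_wpDl.
have e0 : 0 < e by rewrite divr_gt0 // mulr_gt0.
have fe : eps_isometric_on e E f.
  move=> _ [c ->]; rewrite fK -normr_gt0 jiiso => x0; split.
    by rewrite mulrC ltr_pdivrMr ?ltr_pMr //; lra.
  by rewrite ltr_pMl //; lra.
have fU : (opnorm_on E (fun x => (U (f x) - U x)%R) < e%:E)%E.
  apply: (@lt_opnorm_on _ _ _ _ _ 0) => // _ [c ->].
  by rewrite fK jop iop subrr normr0 mul0r.
have [h [_ hiso hop hclose]] := homog e e0 E E' hE hE' f lf fE fe fU.
have [|k _ [c ->]|e' [_ e'e he']] := opnorm_on_lt _ _ hclose.
- by exists (fun=> 0); rewrite comb_const0 !linear0.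
- split; first by exists (fun l => k * c l); rewrite combZ !linearZ.
  by rewrite -!linearZ /= !fK linearZ /= scalerBr !linearZ.
pose a' k := h (j (v k)).
have a'E m c : comb m c a' = h (j (comb m c v)) by rewrite !linear_comb.
exists a'; split=> c.
  rewrite a'E hiso // jiso // hop jop vop vnorm subrr normr0 addrAC subrr add0r.
  have h1 : 0 <= delta * l1 n.+1 c by rewrite mulr_ge0 ?l1_ge0 // ltW.
  split=> //; rewrite ger0_norm /eta; lra.
rewrite a'E; set w := comb n c a.
apply: (le_trans (ler_distD (h (j (i w))) _ _)).
have h1 : `|h (j (comb n c v)) - h (j (i w))| <= q c + 2 * eta * l1 n c.
  by rewrite -!linearB hiso // jiso.
have h2 : `|h (j (i w)) - w| <= e * `|w|.
  have := he' (j (i w)); rewrite fK jiiso => h2; apply: (le_trans (h2 _)); first by exists c.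
  by rewrite ler_wpM2r // ltW.
have h3 : e * `|w| <= delta / 2 * l1 n c.
  have -> : delta / 2 * l1 n c = e * ((M + 1) * l1 n c) by rewrite /e; field; lra.
  rewrite ler_wpM2l ?(ltW e0) //; apply: (le_trans (norm_comb_le c aM)).
  by rewrite ler_wpM2r ?l1_ge0 // lerDl.
move: h1; rewrite /eta; lra.
Qed.

End AlmostHomogeneous.

(** * The kernel *)

Section KernelSpace.
Context {R : realType} (S G : completeNormedModType R) (U : {linear G -> S}).

Definition in_kernel : {pred G} := fun x => U x == 0.

Lemma in_kernel_submod : submod_closed in_kernel.
Proof.
split; first by rewrite unfold_in linear0.
by move=> k x y; rewrite !unfold_in linearP => /eqP -> /eqP ->; rewrite scaler0 addr0.
Qed.

HB.instance Definition _ := GRing.isSubmodClosed.Build R G in_kernel in_kernel_submod.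

Record kernel_vector := KernelVector { kernel_val : G; _ : kernel_val \in in_kernel }.

HB.instance Definition _ := [isSub for kernel_val].
HB.instance Definition _ := [Choice of kernel_vector by <:].
HB.instance Definition _ := [SubChoice_isSubLmodule of kernel_vector by <:].

Hypothesis U1 : nonexpansive U.

Let p (x : kernel_vector) : R := `|kernel_val x|.

Let valB (x y : kernel_vector) : kernel_val (x - y) = kernel_val x - kernel_val y.
Proof. exact: (raddfB (val : kernel_vector -> G)). Qed.

Let pD x y : p (x + y) <= p x + p y.
Proof. by have := ler_normD (val x) (val y); rewrite -(raddfD (val : kernel_vector -> G)). Qed.

Let valZ k (x : kernel_vector) : kernel_val (k *: x) = k *: kernel_val x.
Proof. exact: (linearZ_LR (val : {linear kernel_vector -> G})). Qed.

Let pZ k x : p (k *: x) = `|k| * p x.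
Proof. by rewrite /p valZ normrZ. Qed.

Let p0 x : p x = 0 -> x = 0.
Proof. by move=> /normr0_eq0 h; apply: val_inj; rewrite (raddf0 (val : kernel_vector -> G)). Qed.

Let p_complete v : cauchy_in p v -> exists l, limit_in p v l.
Proof.
move=> cv; have [|l hl] := @banach_complete R G (kernel_val \o v).
  by apply: cauchy_le ltr01 _ cv => n m; rewrite mul1r /p valB.
have lK : l \in in_kernel.
  rewrite unfold_in -normr_eq0 eq_le normr_ge0 andbT.
  apply/ler_addgt0Pr => e e0; rewrite add0r; have [N hN] := hl _ e0.
  have vK : U (kernel_val (v N)) = 0 by have := valP (v N); rewrite unfold_in => /eqP.
  rewrite -normrN -[- U l]add0r -vK -linearB; apply: (le_trans (U1 _)).
  by apply: ltW; apply: hN.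
exists (KernelVector lK) => e e0; have [N hN] := hl _ e0.
by exists N => n Nn; rewrite /p valB; exact: hN.
Qed.

Lemma kernel_exists : exists (H : completeNormedModType R), kernel_isometric_to U H.
Proof.
pose P : banach_norm kernel_vector := BanachNorm pD pZ p0 p_complete.
exists (normed_by P : completeNormedModType R).
have [k kE] : exists k : {linear normed_by P -> G}, k =1 kernel_val.
  by apply: linear_exists => a x y; exact: (linearP (val : kernel_vector -> G)).
exists k; split; first by move=> x _; rewrite kE.
apply/seteqP; split=> x /=.
  by move=> [y _ <-]; rewrite kE; have := valP y; rewrite unfold_in => /eqP.
by move=> /eqP Ux; exists (KernelVector (Ux : x \in in_kernel)); rewrite ?kE.
Qed.

End KernelSpace.

Section KernelGurarii.
Context {R : realType} (S G : completeNormedModType R) (U : {linear G -> S}).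
Hypotheses (U1 : nonexpansive U) (sS : separable S) (sG : separable G).
Hypotheses (univ : universal_operator U) (homog : almost_homogeneous_operator U).

Lemma isometric_section : exists V : {linear S -> G}, isometric V /\ forall s, U (V s) = s.
Proof.
have [I hI] : exists I : {linear S -> S}, I =1 id by exact: linear_exists.
have [|V [Viso UV]] := univ sS (T := I); last by exists V; split=> // s; rewrite UV hI.
by apply/opnorm_le1 => x; rewrite hI.
Qed.

(** Only the coordinates below [n] are determined, hence linear. *)
Lemma basis_coordinates (E : completeNormedModType R) n (b : nat -> E) :
  independent n b -> (forall x, exists c, x = comb n c b) ->
  exists gamma : E -> nat -> R,
    [/\ forall x, comb n (gamma x) b = x,
        forall c i, (i < n)%N -> gamma (comb n c b) i = c i
      & forall k x y i, (i < n)%N -> gamma (k *: x + y) i = k * gamma x i + gamma y i].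
Proof.
move=> ind /choice[gamma hg].
have uniq c d : comb n c b = comb n d b -> forall i, (i < n)%N -> c i = d i.
  move=> cd i iln; apply/eqP; rewrite -subr_eq0; apply/eqP.
  apply: (l1_eq0 (n := n) (c := fun i => c i - d i)) => //.
  by apply: ind; rewrite combB cd subrr.
exists gamma; split=> [x|c|k x y]; first by rewrite -hg.
  by apply: uniq; rewrite -hg.
by apply: uniq; rewrite combD combZ -!hg.
Qed.

Variables (H : completeNormedModType R) (k : {linear H -> G}).
Hypotheses (kiso : isometric k) (kU : range k = [set x | U x = 0]).

Lemma kernel_null x : U (k x) = 0.
Proof. by have : range k (k x); [exists x|rewrite kU]. Qed.

Lemma kernel_lift (Y : completeNormedModType R) (g : {linear Y -> G}) :
  (forall y, U (g y) = 0) -> exists g' : {linear Y -> H}, forall y, k (g' y) = g y.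
Proof.
move=> Ug; have /choice[g0 g0E] : forall y, exists x, k x = g y.
  by move=> y; have : [set x | U x = 0] (g y) by []; rewrite -kU => -[x _ <-]; exists x.
have [g' g'E] : exists g' : {linear Y -> H}, g' =1 g0.
  apply: linear_exists => a y y'; apply/eqP; rewrite -subr_eq0 -normr_eq0 -(kiso I).
  by rewrite linearB linearP !g0E linearP subrr normr0.
by exists g' => y; rewrite g'E.
Qed.

(** [x - V (U x)] is a bounded projection of [G] onto the kernel. *)
Lemma kernel_separable : separable H.
Proof.
have [V [Viso UV]] := isometric_section.
have [Q QE] : exists Q : {linear G -> G}, Q =1 fun x => x - V (U x).
  by apply: linear_exists => a x y; rewrite (linearP U) (linearP V) scalerBr opprD addrACA.
have [|Q' Q'E] := @kernel_lift G Q; first by move=> x; rewrite QE linearB UV subrr.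
have Q'2 x : `|Q' x| <= 2 * `|x|.
  rewrite -(kiso I) Q'E QE; apply: (le_trans (ler_normB _ _)).
  rewrite Viso //; have := U1 x; lra.
apply/separableP; have [D [cD dD]] := approximable_image Q'2 ((separableP _).1 sG).
exists D; split=> // x _; apply: dD; exists (k x) => //.
apply/eqP; rewrite -subr_eq0 -normr_eq0 -(kiso I) linearB Q'E QE kernel_null linear0.
by rewrite subr0 subrr normr0.
Qed.

(** Universality for the zero operator gives an isometric embedding [j] of [Y] in the
kernel; on [X] it differs from [k \o f] by an isometry between subspaces of the
kernel, which almost homogeneity approximates by an isometry preserving [U]. *)
Lemma approx_kernel_embedding (Y : completeNormedModType R) (X : set Y) (f : Y -> H) (delta : R) :
  finite_dimensional Y -> fin_dim_subspace X -> linear_on X f -> isometric_on X f ->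
  0 < delta ->
  exists g : {linear Y -> G}, [/\ isometric g, forall y, U (g y) = 0
    & forall x, X x -> `|g x - k (f x)| <= delta * `|x|].
Proof.
move=> Yfin /fin_dim_subspaceP[n [b hX]] lf fiso delta0.
have fcomb := linear_on_comb lf hX.
have [T TE] : exists T : {linear Y -> S}, T =1 fun=> 0.
  by apply: linear_exists => a x y; rewrite scaler0 addr0.
have [|j [jiso Uj]] := univ (finite_dimensional_separable Yfin) (T := T).
  by apply/opnorm_le1 => x; rewrite TE normr0.
pose E := [set z | exists c, z = j (comb n c b)].
pose E' := [set z | exists c, z = k (f (comb n c b))].
have hE : fin_dim_subspace E.
  apply/fin_dim_subspaceP; exists n, (j \o b) => z.
  by split=> -[c ->]; exists c; rewrite linear_comb.
have hE' : fin_dim_subspace E'.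
  apply/fin_dim_subspaceP; exists n, (k \o (f \o b)) => z.
  by split=> -[c ->]; exists c; rewrite fcomb linear_comb.
pose phi z := k (f (xget 0 [set y | j y = z])).
have jK w : xget 0 [set y | j y = j w] = w.
  case: xgetP => [w' _ /= h|/(_ w)]; last by move=> /(_ erefl).
  by apply/eqP; rewrite -subr_eq0 -normr_eq0 -(jiso _ I) linearB h subrr normr0.
have phiE w : phi (j w) = k (f w) by rewrite /phi jK.
have Xc c : X (comb n c b) by apply/hX; exists c.
have lphi : linear_on E phi.
  by move=> a _ _ [c ->] [d ->]; rewrite -linearP !phiE lf ?linearP.
have phiE' x : E x -> E' (phi x) by move=> [c ->]; rewrite phiE; exists c.
have phinorm c : `|phi (j (comb n c b))| = `|j (comb n c b)|.
  by rewrite phiE kiso // jiso // fiso.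
have ephi : eps_isometric_on delta E phi.
  move=> _ [c ->]; rewrite phinorm -normr_gt0 => x0; split.
    by rewrite mulrC ltr_pdivrMr ?ltr_pMr //; lra.
  by rewrite ltr_pMl //; lra.
have Uphi : (opnorm_on E (fun x => (U (phi x) - U x)%R) < delta%:E)%E.
  apply: (@lt_opnorm_on _ _ _ _ _ 0) => // _ [c ->].
  by rewrite phiE kernel_null Uj TE subrr normr0 mul0r.
have [h [_ hiso Uh hclose]] := homog delta0 hE hE' lphi phiE' ephi Uphi.
have [|a _ [c ->]|e' [_ e'e he']] := opnorm_on_lt _ _ hclose.
- by exists (fun=> 0); rewrite comb_const0 linear0.
- split; first by exists (fun l => a * c l); rewrite combZ linearZ.
  have -> : a *: j (comb n c b) = j (comb n (fun l => a * c l) b) by rewrite combZ linearZ.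
  rewrite !phiE !fcomb !combZ scalerBr; congr (_ - _); first by rewrite !linearZ.
  by rewrite linearZ.
have [g gE] : exists g : {linear Y -> G}, g =1 h \o j.
  by apply: linear_exists => a x y; rewrite /= !linearP.
exists g; split=> [x _|y|x /hX[c ->]].
- by rewrite gE /= hiso // jiso.
- by rewrite gE /= Uh Uj TE.
- rewrite gE /= -phiE; apply: le_trans (he' _ _) _; first by exists c.
  by rewrite jiso // ler_wpM2r // ltW.
Qed.

(** The almost extension [g0] of [f] is corrected by the operator that sends [b i] to
[k (f (b i)) - g0 (b i)] and the other vectors of a basis of [Y] to zero.  Its norm
is at most [eta]. *)
Lemma kernel_Gurarii : is_Gurarii H.
Proof.
split=> [|e e0 Y Yfin X Xfin f lf fiso]; first exact: kernel_separable.
have [n [b [indb hX]]] := fin_dim_basis Xfin.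
have [m [y hY]] := (fin_dim_subspaceP _).1 Yfin.
have [N [b' [nN ind' bb' span]]] := extend_basis m y indb.
have spanY z : exists c, z = comb N c b'.
  apply/span; have [d ->] := (hY z).1 I.
  by exists (fun=> 0), d; rewrite comb_const0 add0r.
have [gamma [gammaE gammaK gammaP]] := basis_coordinates ind' spanY.
have [C C0 hC] := basis_bound ind'.
have [M M0 bM] := tuple_bounded n b.
(* Half of [1 - (1 + e)^-1]: then [1 - eta] exceeds [(1 + e)^-1]. *)
pose eta := e / (2 * (1 + e)).
have eta0 : 0 < eta by rewrite divr_gt0 // mulr_gt0 //; lra.
pose delta := eta / ((M + 1) * C).
have MC : 0 < (M + 1) * C by rewrite mulr_gt0 // ltr_wpDl.
have delta0 : 0 < delta by rewrite divr_gt0.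
have [g0 [g0iso Ug0 g0f]] := approx_kernel_embedding Yfin Xfin lf fiso delta0.
have fcomb := linear_on_comb lf hX.
pose w i := k (f (b i)) - g0 (b i).
have wE c : comb n c w = k (f (comb n c b)) - g0 (comb n c b).
  by rewrite fcomb (linear_comb k) (linear_comb g0) combBr.
have Xc c : X (comb n c b) by apply/hX; exists c.
have [g1 g1E] : exists g1 : {linear Y -> G}, g1 =1 fun z => g0 z + comb n (gamma z) w.
  apply: linear_exists => a x z; rewrite linearP scalerDr addrACA; congr (_ + _).
  rewrite -combZ -combD; apply: eq_comb => i iln.
  by rewrite gammaP // (leq_trans iln).
have Ug1 z : U (g1 z) = 0.
  by rewrite g1E wE linearD linearB kernel_null !Ug0 subrr addr0.
have [g gE] := kernel_lift Ug1.
have small z : `|g1 z - g0 z| <= eta * `|z|.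
  rewrite g1E addrC addKr wE distrC; apply: (le_trans (g0f _ (Xc _))).
  have h1 : `|comb n (gamma z) b| <= (M + 1) * (C * `|z|).
    apply: (@le_trans _ _ ((M + 1) * l1 n (gamma z))).
      apply: (le_trans (norm_comb_le _ bM)); by rewrite ler_wpM2r ?l1_ge0 // lerDl.
    rewrite ler_wpM2l ?addr_ge0 // (le_trans (l1_widen _ nN)) //.
    by rewrite -{2}(gammaE z).
  have -> : eta * `|z| = delta * ((M + 1) * (C * `|z|)).
    by rewrite /delta; field; rewrite !gt_eqF //; lra.
  by rewrite ler_wpM2l // ltW.
exists g; split=> [z _ z0|x Xx].
  have nz : 0 < `|z| by rewrite normr_gt0.
  rewrite -(kiso (x := g z) I) gE.
  have := le_trans (ler_dist_dist _ _) (small z); rewrite g0iso // ler_norml => /andP[h1 h2].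
  have etae : eta * (2 * (1 + e)) = e by rewrite /eta; field; lra.
  have etalt : eta < e.
    have := mulr_gt0 eta0 e0; lra.
  split; last first.
    have := ltr_pM2r nz eta e; rewrite etalt => h3; lra.
  have : (1 + e)^-1 * `|z| < (1 - eta) * `|z|.
    rewrite ltr_pM2r // -[ltLHS]mul1r ltr_pdivrMr; last lra.
    have := mulr_gt0 eta0 e0; lra.
  lra.
apply/eqP; rewrite -subr_eq0 -normr_eq0 -(kiso I) linearB gE g1E.
have [c xc] := (hX x).1 Xx.
have -> : comb n (gamma x) w = comb n c w.
  apply: eq_comb => i iln; split=> //.
  have -> : x = comb N (trunc n c) b'.
    by rewrite comb_trunc // xc; apply: eq_comb => l ln; rewrite bb'.
  by rewrite gammaK ?(leq_trans iln) // /trunc iln.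
by rewrite wE -xc (addrC (g0 x)) subrK subrr normr0.
Qed.

End KernelGurarii.

(** * The universal operator *)

Lemma completed_union_separable (R : realType) (S : completeNormedModType R)
    (u : heart_seq S) (G : completeNormedModType R) (iota : forall n, {linear u n -> G}) :
  completed_union iota -> separable G.
Proof.
move=> [iiso _ dG]; apply: dense_approximable dG _.
apply: approximable_bigcup => n; apply: (@approximable_image _ _ _ _ 1).
  by move=> x; rewrite mul1r iiso.
by apply: fin_dim_approximable; exact: Kspace_fin.
Qed.

Theorem theorem4p6 (R : realType) (S : completeNormedModType R)
    (sepS : separable S)
    (u : heart_seq S) (Fu : Fraisse_sequence u)
    (G : completeNormedModType R) (iota : forall n, {linear u n -> G})
    (Gu : completed_union iota)
    (U : {linear G -> S}) (bU : bounded_near U (nbhs 0))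
    (Uu : forall n z, U (iota n z) = Kop (u n) z) :
  [/\ universal_operator U,
      almost_homogeneous_operator U,
      right_invertible_operator U /\
        (exists H : completeNormedModType R,
           is_Gurarii H /\ kernel_isometric_to U H)
    & forall (G' : completeNormedModType R) (U' : {linear G' -> S}),
        separable G' -> (opnorm U' <= 1)%E ->
        universal_operator U' -> almost_homogeneous_operator U' ->
        exists h : {linear G -> G'},
          [/\ bijective h, isometric h & forall x, U' (h x) = U x]].
Proof.
have [_ Au] := Fu.
have U1 := limit_operator_nonexpansive Gu bU Uu.
have sG := completed_union_separable Gu.
have ext := Fraisse_extendable Au Gu bU Uu.
have univ := extendable_universal U1 ext.
have homog := extendable_almost_homogeneous U1 sG ext.
split=> //.
  split.
    have [V [Viso UV]] := isometric_section sepS univ.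
    exists V; split=> //; apply/linear_boundedP; exists 1; split=> // r r1 x.
    by rewrite Viso // ler_peMl // ltW.
  have [H kerH] := kernel_exists U1; exists H; split=> //.
  have [k [kiso kU]] := kerH.
  exact: kernel_Gurarii U1 sepS sG univ homog _ _ kiso kU.
move=> G' U' sG' /opnorm_le1 U'1 univ' homog'.
have ext' := universal_homogeneous_extendable U'1 sG' univ' homog'.
have sim0 : almost_eq U U' 0 (fun c => 1 * l1 0 c) (fun=> 0) (fun=> 0).
  move=> c; rewrite !comb0 !linear0 !normr0 !subrr !normr0 addr0 normr0.
  by split; rewrite mulr_ge0 ?l1_ge0.
have [h [hbij hiso hop _]] :=
  back_and_forth U1 U'1 ext ext' sG sG' (gauge_l1 0 ler01) sim0 ltr01.
by exists h.
Qed.
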